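(* For mutual exclusion protocols (each considered together with the memory model of its shared registers), the following implications between liveness properties hold: (1) bounded bypass $\Rightarrow$ post-doorway bounded bypass; (2) bounded bypass $\Rightarrow$ intermittent bounded bypass; (3) post-doorway bounded bypass $\Rightarrow$ starvation-freedom; (4) intermittent bounded bypass $\Rightarrow$ starvation-freedom; (5) starvation-freedom $\Rightarrow$ deadlock-freedom. Moreover, no implication between two distinct properties among these five holds in general, other than (1)–(5) and those obtained from them by transitivity. That is, for any two of these properties $P \neq Q$ such that $P\Rightarrow Q$ is not obtained from (1)–(5) by transitivity, there is a mutual exclusion protocol (with some memory model) that satisfies $P$ but not $Q$. In particular: deadlock-freedom does not imply starvation-freedom; starvation-freedom implies neither post-doorway nor intermittent bounded bypass; neither post-doorway nor intermittent bounded bypass implies bounded bypass; and neither of post-doorway bounded bypass and intermittent bounded bypass implies the other.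
   Context: Setting. A system has $n\ge 1$ processes $p_0,\dots,p_{n-1}$ running in parallel, each sequentially executing its code. Processes are reliable (each correctly executes its code and keeps making progress in it) and asynchronous (they proceed at arbitrary finite speed). They interact through shared registers, on which only reads and writes are available; reads and writes take time, are non-blocking, may overlap in time, and always terminate. A mutual exclusion protocol provides functions $\mathtt{lock}$ (run to get access to a critical section) and $\mathtt{unlock}$ (run when leaving it), ensuring that at most one process at a time is in a critical section. A process may invoke $\mathtt{lock}$ any number of times; when its $\mathtt{lock}$ terminates it enters its critical section, which it leaves after finite time, then running $\mathtt{unlock}$. A protocol may be designed for all $n$ or for a specific $n$. Memory models (overlapping writes on one register need not be considered for regular registers). A register is safe if: initially, and whenever a write terminates while no other write on it is going on, it contains a well-defined value that does not change until a next write commences; when a write of $v$ that overlaps no other write terminates, $v$ becomes its value; a read overlapping no write returns its value. A read overlapping a write may return any value of the register's domain, and after overlapping writes the register may hold any value of its domain. It is regular if moreover a read overlapping some writes returns either a value written by one of these writes or the value of the register before the first of these writes started. It is atomic if it behaves as if each read and write takes effect at a single point in time (its execution point) between its start and its termination, different actions having different execution points. A process $p_i$ running $\mathtt{lock}$ loses a competition with (is bypassed by) $p_j$, $j \neq i$, each time a $\mathtt{lock}$ of $p_j$ that overlaps in time with that $\mathtt{lock}$ of $p_i$ terminates earlier than it; the loss occurs at the moment $p_j$'s $\mathtt{lock}$ terminates. Liveness properties of a protocol. • Deadlock-freedom: whenever at some time $t$ at least one process is running its $\mathtt{lock}$, then afterwards some process (not necessarily one running $\mathtt{lock}$ at time $t$)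 will enter its critical section. • Starvation-freedom: every invocation of $\mathtt{lock}$ eventually terminates (and lets the invoking process enter its critical section). • Bounded bypass: there is a function $f(n)$ such that every process that invokes $\mathtt{lock}$ enters the critical section, after losing at most $f(n)$ competitions from the moment in which it completes the execution of the first instruction of the $\mathtt{lock}$. Here the first instruction of $\mathtt{lock}$ is taken to be a write to a shared register. • Post-doorway bounded bypass: there are a function $f(n)$ and an initial portion of the $\mathtt{lock}$ whose execution requires only a bounded number of elementary actions (the doorway) such that every process that invokes $\mathtt{lock}$ enters the critical section, after losing at most $f(n)$ competitions from the moment in which it completes the doorway. • Intermittent bounded bypass: there are functions $f(n),h(n)$ such that a set $S$ of assignments (writes) to shared registers can be defined, such that each time a process $p_i$ starts its $\mathtt{lock}$, it will reach its critical section after a period $\pi$ such that at most $h(n)$ assignments in $S$ are made within $\pi$, and $p_i$ loses at most $f(n)$ competitions in those parts of $\pi$ that are outside the execution of assignments in $S$. Here $\mathtt{lock}$ is said to start when its first instruction starts; assignments in $S$ may be made by any process, and membership in $S$ may depend on the process $p_i$ considered and on the run. *)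

(* Defs.v *)
From Stdlib Require Relation_Operators.
From mathcomp Require Import all_boot.

Set Implicit Arguments.
Unset Strict Implicit.
Unset Printing Implicit Defensive.

Inductive memory_model := Safe | Regular | Atomic.

(* The instructions of [lock] and [unlock].  [priv] is the private state of a
   process (program counter and local variables); [Read r k] continues in the
   private state [k v] when the read returns [v].  [Return p] terminates the
   current function and leaves [p] as the private state in which the next call
   (of [unlock] after [lock], of [lock] after [unlock]) starts. *)
Inductive instr (reg : Type) (dom : reg -> Type) (priv : Type) : Type :=
| Read (r : reg) (k : dom r -> priv)
| Write (r : reg) (v : dom r) (p : priv)
| Local (p : priv)
| Return (p : priv).

Arguments Read {reg dom priv} r k.
Arguments Write {reg dom priv} r v p.
Arguments Local {reg dom priv} p.
Arguments Return {reg dom priv} p.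

Record system (n : nat) := System {
  reg : Type;
  dom : reg -> Type;
  init : forall r, dom r;
  priv : Type;
  priv0 : 'I_n -> priv;
  lock : 'I_n -> priv -> instr dom priv;
  unlock : 'I_n -> priv -> instr dom priv
}.

Inductive sect := Remainder | Locking | Critical | Unlocking.

Section Runs.

Variables (n : nat) (S : system n).

(* [busy] holds while the current instruction is a read or a write that has
   started and has not terminated yet. *)
Record pstate := PState { sec : sect; loc : priv S; busy : bool }.

Definition current (i : 'I_n) (x : pstate) : option (instr (@dom n S) (priv S)) :=
  match sec x with
  | Locking => Some (lock i (loc x))
  | Unlocking => Some (unlock i (loc x))
  | Remainder | Critical => None
  end.

(* The steps of process [i]; [ret r v] says that a read of [r] that terminates
   in this step may return [v]. *)
Inductive pstep (i : 'I_n) (ret : forall r : reg S, dom r -> Prop) :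
    pstate -> pstate -> Prop :=
| Invoke p :
    pstep i ret (PState Remainder p false) (PState Locking p false)
| Leave p :
    pstep i ret (PState Critical p false) (PState Unlocking p false)
| StartRead s p r k :
    current i (PState s p false) = Some (Read r k) ->
    pstep i ret (PState s p false) (PState s p true)
| StartWrite s p r v q :
    current i (PState s p false) = Some (Write r v q) ->
    pstep i ret (PState s p false) (PState s p true)
| EndRead s p r k v :
    current i (PState s p true) = Some (Read r k) -> ret r v ->
    pstep i ret (PState s p true) (PState s (k v) false)
| EndWrite s p r v q :
    current i (PState s p true) = Some (Write r v q) ->
    pstep i ret (PState s p true) (PState s q false)
| LocalStep s p q :
    current i (PState s p false) = Some (Local q) ->
    pstep i ret (PState s p false) (PState s q false)
| ReturnLock p q :
    current i (PState Locking p false) = Some (Return q) ->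
    pstep i ret (PState Locking p false) (PState Critical q false)
| ReturnUnlock p q :
    current i (PState Unlocking p false) = Some (Return q) ->
    pstep i ret (PState Unlocking p false) (PState Remainder q false).

(* Time is discrete: [st t] is the global state just before the event of time
   [t], and [act t] is the process that makes a step at time [t] ([None] if no
   process does).  [content t r] is the value of register [r] in state [t]; it
   is meaningful for non-atomic registers only when no write on [r] is going
   on.  [point t = Some i] says that time [t] is the execution point of the
   access of [i] going on at [t]; it is used for atomic registers only. *)
Record history := History {
  act : nat -> option 'I_n;
  st : nat -> 'I_n -> pstate;
  content : nat -> forall r : reg S, dom r;
  point : nat -> option 'I_n
}.

Variable R : history.

(* The read or write of [i] that starts at time [s] is going on in state [t].
   An access that starts at [s] and terminates at [e] is going on exactly in
   the states [s.+1], ..., [e], so two accesses overlap in time iff they are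
   both going on in some common state. *)
Definition ongoing (i : 'I_n) (s t : nat) : Prop :=
  [/\ s < t, ~~ busy (st R s i) & forall u, s < u <= t -> busy (st R u i)].

Definition writes (t : nat) (i : 'I_n) (r : reg S) (v : dom r) : Prop :=
  busy (st R t i) /\ exists q, current i (st R t i) = Some (Write r v q).

Definition writing (t : nat) (i : 'I_n) (r : reg S) : Prop :=
  exists v, writes t i (r := r) v.

Definition initial_content : Prop := forall r, content R 0 r = init r.

Definition nonatomic_content : Prop :=
  (forall t r, (forall i, ~ writing t i r) ->
     content R t.+1 r = content R t r) /\
  (forall s t i r (v : dom r),
     ongoing i s t -> act R t = Some i -> writes t i v ->
     (forall u j, s < u <= t -> j <> i -> ~ writing u j r) ->
     content R t.+1 r = v).

Definition atomic_content : Prop :=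
  [/\ forall t i, point R t = Some i ->
        busy (st R t i) /\ act R t <> Some i,
      forall i s t, ongoing i s t -> act R t = Some i ->
        exists! x, s < x < t /\ point R x = Some i,
      forall t i r (v : dom r), point R t = Some i -> writes t i v ->
        content R t.+1 r = v &
      forall t r, (forall i, point R t = Some i -> ~ writing t i r) ->
        content R t.+1 r = content R t r].

Definition memory_ok (M : memory_model) : Prop :=
  initial_content /\
  match M with
  | Safe | Regular => nonatomic_content
  | Atomic => atomic_content
  end.

(* The possible results [v] of a read of [r] from time [s] to time [t]. *)
Definition safe_result (s t : nat) (r : reg S) (v : dom r) : Prop :=
  (forall u j, s < u <= t -> ~ writing u j r) -> v = content R t r.

Definition overlapping_write (s t : nat) (r : reg S) (j : 'I_n) (s' : nat) :
    Prop :=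
  exists u, [/\ s < u <= t, writing u j r & ongoing j s' u].

Definition regular_result (s t : nat) (r : reg S) (v : dom r) : Prop :=
  safe_result s t v /\
  ((exists j s', overlapping_write s t r j s') ->
   (exists u j, s < u <= t /\ writes u j v) \/
   (exists j0 s0,
      [/\ overlapping_write s t r j0 s0,
          forall j s', overlapping_write s t r j s' -> s0 <= s' &
          v = content R s0 r])).

Definition atomic_result (i : 'I_n) (s t : nat) (r : reg S) (v : dom r) : Prop :=
  exists x, [/\ s < x < t, point R x = Some i & v = content R x r].

Definition read_result (M : memory_model) (i : 'I_n) (t : nat)
    (r : reg S) (v : dom r) : Prop :=
  exists2 s, ongoing i s t &
    match M with
    | Safe => safe_result s t v
    | Regular => regular_result s t v
    | Atomic => atomic_result i s t v
    end.

(* The last clause expresses that processes are reliable, that accesses to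
   registers terminate and that critical sections are left after finite time; a
   process may stay in its remainder section forever. *)
Definition run (M : memory_model) : Prop :=
  [/\ forall i, st R 0 i = PState Remainder (priv0 S i) false,
      forall t, match act R t with
        | None => forall j, st R t.+1 j = st R t j
        | Some i =>
            pstep i (read_result M i t) (st R t i) (st R t.+1 i) /\
            forall j, j <> i -> st R t.+1 j = st R t j
        end,
      memory_ok M &
      forall t i, sec (st R t i) <> Remainder ->
        exists2 u, t <= u & act R u = Some i].

Definition mutual_exclusion : Prop :=
  forall t i j, sec (st R t i) = Critical -> sec (st R t j) = Critical -> i = j.

Definition no_overlapping_writes : Prop :=
  forall t i j r, writing t i r -> writing t j r -> i = j.

Definition invokes (i : 'I_n) (a : nat) : Prop :=
  act R a = Some i /\ sec (st R a i) = Remainder.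

Definition enters (i : 'I_n) (b : nat) : Prop :=
  sec (st R b i) = Locking /\ sec (st R b.+1 i) = Critical.

(* The [lock] of [i] invoked at time [a] terminates at time [b]. *)
Definition lock_exec (i : 'I_n) (a b : nat) : Prop :=
  [/\ invokes i a, a < b,
      forall u, a < u <= b -> sec (st R u i) = Locking & enters i b].

(* [i] loses a competition at time [t]: as [i] is running [lock] at the moment
   when the [lock] of [j] terminates, these executions of [lock] overlap. *)
Definition loses (i : 'I_n) (t : nat) : Prop :=
  sec (st R t i) = Locking /\ exists2 j, j <> i & enters j t.

(* At time [t], [i] completes an elementary action of its [lock]: every step
   other than the start of a read or a write does. *)
Definition completes (i : 'I_n) (t : nat) : bool :=
  [&& act R t == Some i, if sec (st R t i) is Locking then true else false
    & ~~ busy (st R t.+1 i)].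

Definition starts_first (i : 'I_n) (a c : nat) : Prop :=
  [/\ a < c, act R c = Some i & forall u, a < u < c -> act R u <> Some i].

Definition completes_first (i : 'I_n) (a c : nat) : Prop :=
  [/\ a < c, completes i c & forall u, a < u < c -> ~~ completes i u].

Definition first_is_write (i : 'I_n) (a : nat) : Prop :=
  exists r v q, lock i (loc (st R a i)) = @Write _ (@dom n S) _ r v q.

(* The private states that [i] has gone through in the [lock] invoked at [a],
   up to state [t]: the initial one, then one for each completed action. *)
Definition trail (i : 'I_n) (a t : nat) : seq (priv S) :=
  loc (st R a i) ::
  [seq loc (st R u.+1 i) | u <- index_iota a.+1 t & completes i u].

(* A portion of [lock] is given by the trails [D i] for which process [i] is
   still in it; trails instead of private states distinguish a first pass
   through a piece of code from later ones.  The doorway is completed at the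
   first action after which the trail is not in [D i]. *)
Definition completes_doorway (D : 'I_n -> seq (priv S) -> Prop)
    (i : 'I_n) (a c : nat) : Prop :=
  [/\ a < c, completes i c,
      forall u, a < u <= c -> D i (trail i a u) & ~ D i (trail i a c.+1)].

Definition assignment (j : 'I_n) (s : nat) : Prop :=
  exists r, writing s.+1 j r /\ ongoing j s s.+1.

End Runs.

Definition at_most (T : eqType) (k : nat) (A : T -> Prop) : Prop :=
  forall s : seq T, uniq s -> (forall x, x \in s -> A x) -> size s <= k.

Inductive protocol :=
| ForAll of forall n, system n
| ForSize n of 0 < n & system n.

Definition each (P : protocol) (Q : forall n, system n -> Prop) : Prop :=
  match P with
  | ForAll F => forall n, 0 < n -> Q n (F n)
  | ForSize n _ F => Q n F
  end.

(* Overlapping writes are excluded, not given a meaning, for regular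
   registers. *)
Definition mutex_protocol (M : memory_model) (P : protocol) : Prop :=
  each P (fun n S => forall R : history S, run R M ->
    mutual_exclusion R /\ (M = Regular -> no_overlapping_writes R)).

Definition lock_starts_with_write (M : memory_model) (P : protocol) : Prop :=
  each P (fun n S => forall R : history S, run R M ->
    forall i a, invokes R i a -> first_is_write R i a).

Definition deadlock_freedom (M : memory_model) (P : protocol) : Prop :=
  each P (fun n S => forall R : history S, run R M ->
    forall t i, sec (st R t i) = Locking ->
    exists2 u, t <= u & exists j, enters R j u).

Definition starvation_freedom (M : memory_model) (P : protocol) : Prop :=
  each P (fun n S => forall R : history S, run R M ->
    forall i a, invokes R i a -> exists b, lock_exec R i a b).

Definition bounded_bypass (M : memory_model) (P : protocol) : Prop :=
  exists f : nat -> nat,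
  each P (fun n S => forall R : history S, run R M ->
    forall i a, invokes R i a ->
    first_is_write R i a /\
    exists b c,
      [/\ lock_exec R i a b, completes_first R i a c &
          at_most (f n) (fun u => c < u < b /\ loses R i u)]).

(* [d] bounds the number of elementary actions in the doorway. *)
Definition post_doorway_bounded_bypass (M : memory_model) (P : protocol) :
    Prop :=
  exists f d : nat -> nat,
  each P (fun n S => exists D : 'I_n -> seq (priv S) -> Prop,
    forall R : history S, run R M ->
    forall i a, invokes R i a ->
    exists b c,
      [/\ lock_exec R i a b, completes_doorway R D i a c, c <= b,
          (size (trail R i a c.+1)).-1 <= d n &
          at_most (f n) (fun u => c < u < b /\ loses R i u)]).

(* [A j s] says that the write of [j] that starts at time [s] is in the set of
   assignments; the period extends from the start [c] of the first instruction
   of [lock] to the end [b] of [lock]. *)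
Definition intermittent_bounded_bypass (M : memory_model) (P : protocol) :
    Prop :=
  exists f h : nat -> nat,
  each P (fun n S => forall R : history S, run R M -> forall i,
    exists A : 'I_n -> nat -> Prop,
    (forall j s, A j s -> assignment R j s) /\
    forall a, invokes R i a ->
    exists b c,
      [/\ lock_exec R i a b, starts_first R i a c,
          at_most (h n) (fun w : 'I_n * nat =>
            A w.1 w.2 /\ exists2 u, c < u <= b & ongoing R w.1 w.2 u) &
          at_most (f n) (fun u =>
            [/\ c < u < b, loses R i u &
                ~ exists j s, A j s /\ ongoing R j s u])]).

Inductive property :=
| DeadlockFreedom
| StarvationFreedom
| BoundedBypass
| PostDoorwayBoundedBypass
| IntermittentBoundedBypass.

Definition satisfies (M : memory_model) (P : protocol) (p : property) : Prop :=
  match p with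
  | DeadlockFreedom => deadlock_freedom M P
  | StarvationFreedom => starvation_freedom M P
  | BoundedBypass => bounded_bypass M P
  | PostDoorwayBoundedBypass => post_doorway_bounded_bypass M P
  | IntermittentBoundedBypass => intermittent_bounded_bypass M P
  end.

Definition entails (p q : property) : Prop :=
  forall M P, mutex_protocol M P -> satisfies M P p -> satisfies M P q.

(* The lock of the witness starts with a write, so that a failure of bounded
   bypass is never due merely to that requirement in its definition. *)
Definition separated (p q : property) : Prop :=
  exists M P,
    [/\ mutex_protocol M P, lock_starts_with_write M P,
        satisfies M P p & ~ satisfies M P q].

Inductive basic : property -> property -> Prop :=
| basic1 : basic BoundedBypass PostDoorwayBoundedBypass
| basic2 : basic BoundedBypass IntermittentBoundedBypass
| basic3 : basic PostDoorwayBoundedBypass StarvationFreedom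
| basic4 : basic IntermittentBoundedBypass StarvationFreedom
| basic5 : basic StarvationFreedom DeadlockFreedom.

Definition obtained : property -> property -> Prop :=
  Relation_Operators.clos_trans property basic.

(* Main.v *)
Require Import Defs.
#[warnings="-notation-overridden"] From mathcomp Require Import all_boot zify.
From Stdlib Require Import Relation_Operators.

(* The implications only require unfolding; for (2), S consists of the writes
   that are the first instruction of some [lock] of the process.

   By the implications, all non-implications reduce to three.  Each is
   witnessed by Lamport's bakery algorithm for two processes on safe registers,
   preceded by a prefix that starts with a write; after the prefix a process
   loses at most two competitions.
   - [Retry]: the prefix waits until the ticket of the other process is 0.  A
     process starves if it always reads while the other one holds a ticket, but
     a process beyond its prefix gets through.
   - [Once]: the prefix reads the ticket of the other process once and ignores
     the result.  The prefix is a doorway, but while this read is in progress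
     there is no bound on the number of competitions lost, and a read is not an
     assignment.
   - [Countdown]: the prefix raises the own door, reads the ticket of the other
     process and counts down from the value read, which is arbitrarily large if
     the read overlaps a write; then the door is raised again.  While that
     second write is in progress the other process may keep reading the
     door as lowered and overtake, so there is no bound on the number of lost
     competitions after any bounded initial portion of [lock]; but all of these
     losses occur within a single assignment. *)

Set Implicit Arguments.
Unset Strict Implicit.
Unset Printing Implicit Defensive.

(** * Runs of arbitrary protocols and the implications *)

Lemma pstep_sec n (S : system n) i ret (x y : pstate S) : pstep i ret x y ->
  match sec x with
  | Remainder => y = PState Locking (loc x) false
  | Locking => sec y = Locking \/ [/\ sec y = Critical, ~~ busy x & ~~ busy y]
  | Critical => sec y = Unlocking
  | Unlocking => sec y = Unlocking \/ sec y = Remainder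
  end.
Proof.
by case=> //= [s p r k|s p r v q|s p r k v|s p r v q|s p q|p q _|p q _];
  [case: s | case: s | case: s | case: s | case: s | right | right]; auto.
Qed.

Lemma pstep_start_write n (S : system n) i ret (x y : pstate S) :
  pstep i ret x y -> ~~ busy x ->
  (exists r v q, current i x = Some (@Write _ (@dom n S) _ r v q)) ->
  y = PState (sec x) (loc x) true.
Proof.
case=> //= [p|p|s p q E|p q E|p q E] _ [r [v [w]]]; try by [].
all: by move: E; rewrite /current /= => ->.
Qed.

Section GeneralRuns.

Variables (M : memory_model) (n : nat) (S : system n) (R : history S).
Hypothesis HR : run R M.

Lemma run_step t i : act R t = Some i ->
  pstep i (fun r v => read_result R M i t v) (st R t i) (st R t.+1 i).
Proof. by case: HR => _ /(_ t) + _ _ e; rewrite e => -[]. Qed.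

Lemma run_idle t i : act R t != Some i -> st R t.+1 i = st R t i.
Proof.
case: HR => _ /(_ t) + _ _; case: (act R t) => [j [_ H]|H _]; last exact: H.
by move=> ne; apply: H => e; rewrite e eqxx in ne.
Qed.

Lemma run_idle_until t u i : t <= u ->
  (forall v, t <= v < u -> act R v != Some i) -> st R u i = st R t i.
Proof.
elim: u => [|u IH]; first by rewrite leqn0 => /eqP->.
rewrite leq_eqVlt => /orP[/eqP-> //|tu] H.
rewrite run_idle; last by apply: H; lia.
by apply: IH => // v Hv; apply: H; lia.
Qed.

(** Fairness gives some later step of [i]; the earliest one is taken, so that [i] is still in its
    state of time [t] when it makes this step. *)
Lemma run_next_act t i : sec (st R t i) <> Remainder ->
  exists u, [/\ t <= u, act R u = Some i, st R u i = st R t i &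
    forall v, t <= v < u -> act R v != Some i].
Proof.
case: HR => _ _ _ /[apply] -[u tu Hu].
have ex : exists k, act R (t + k) == Some i.
  by exists (u - t); rewrite subnKC // Hu.
case: (ex_minnP ex) => k /eqP Hk Hmin.
have nact v : t <= v < t + k -> act R v != Some i.
  move=> Hv; apply/negP => Ha; have := Hmin (v - t).
  by rewrite subnKC; [move=> /(_ Ha); lia | lia].
exists (t + k); split=> //; first lia.
by apply: run_idle_until => //; lia.
Qed.

Lemma run_locking_step t i : sec (st R t i) = Locking ->
  sec (st R t.+1 i) = Locking \/ act R t = Some i /\ enters R i t.
Proof.
move=> L; case: (eqVneq (act R t) (Some i)) => [e|/run_idle->]; last by left.
by move: (pstep_sec (run_step e)); rewrite /enters L => -[|[]]; auto.
Qed.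

Lemma run_locking_from t i : sec (st R t i) = Locking ->
  exists a, [/\ a < t, invokes R i a &
    forall u, a < u <= t -> sec (st R u i) = Locking].
Proof.
elim: t => [|t IH]; first by case: HR => -> _ _ _.
case: (eqVneq (act R t) (Some i)) => [e L|/run_idle E].
  case Et: (sec (st R t i)).
  - by exists t; split=> // u Hu; have ->: u = t.+1 by lia.
  - case: (IH Et) => a [at_ ia H]; exists a; split=> //; first lia.
    move=> u Hu; case: (leqP u t) => ut; first by apply: H; lia.
    by have ->: u = t.+1 by lia.
  - by move: (pstep_sec (run_step e)); rewrite Et L => // -[].
  - by move: (pstep_sec (run_step e)); rewrite Et L => // -[].
rewrite E => L; case: (IH L) => a [at_ ia H]; exists a; split=> //; first lia.
move=> u Hu; case: (leqP u t) => ut; first by apply: H; lia.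
by have ->: u = t.+1 by [lia]; rewrite E.
Qed.

Lemma invokes_locking i a : invokes R i a ->
  st R a.+1 i = PState Locking (loc (st R a i)) false.
Proof. by case=> /run_step/pstep_sec + e; rewrite e. Qed.

Lemma lock_exec_of_enters i a u : invokes R i a -> a < u -> enters R i u ->
  exists2 b, lock_exec R i a b & b <= u.
Proof.
move=> ia au eu.
pose ent v := (if sec (st R v i) is Locking then true else false) &&
  (if sec (st R v.+1 i) is Critical then true else false).
have entP v : enters R i v <-> ent v.
  rewrite /enters /ent; case: (sec (st R v i)); case: (sec (st R v.+1 i));
    by split=> // -[].
have ex : exists v, (a < v) && ent v by exists u; rewrite au /=; apply/entP.
case: (ex_minnP ex) => b /andP[ab /entP Eb] Hmin.
exists b; last by apply: Hmin; rewrite au; apply/entP.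
split=> // v Hv; elim: v Hv => [|v IH] Hv; first lia.
case: (ltnP a v) => av; last first.
  by have ->: v = a by [lia]; rewrite (invokes_locking ia).
have Hv' : a < v <= b by lia.
case: (run_locking_step (IH Hv')) => // -[_ /entP E].
by have := Hmin v; rewrite av E => /(_ isT); lia.
Qed.

Lemma enters_act i b : enters R i b ->
  act R b = Some i /\ ~~ busy (st R b i) /\ ~~ busy (st R b.+1 i).
Proof.
case=> L C; case: (eqVneq (act R b) (Some i)) => [e|/run_idle E]; last first.
  by rewrite E L in C.
by move: (pstep_sec (run_step e)); rewrite L C => -[|[]].
Qed.

Lemma starts_first_ex i a : invokes R i a ->
  exists c, [/\ starts_first R i a c, st R c i = st R a.+1 i &
    forall u, a < u <= c -> st R u i = st R a.+1 i].
Proof.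
move=> ia; have L := invokes_locking ia.
have [|c [ac Hc E H]] := @run_next_act a.+1 i; first by rewrite L.
exists c; split=> //; first by split=> // u Hu; apply/eqP/H.
by move=> u Hu; apply: run_idle_until; [lia | move=> v Hv; apply: H; lia].
Qed.

Lemma starts_first_uniq i a c c' :
  starts_first R i a c -> starts_first R i a c' -> c = c'.
Proof.
case=> ac Hc H [ac' Hc' H'].
case: (ltngtP c c') => // cc.
  by case: (H' c); first lia.
by case: (H c'); first lia.
Qed.

End GeneralRuns.

Lemma at_most_sub (T : eqType) k (A B : T -> Prop) :
  (forall x, A x -> B x) -> at_most k B -> at_most k A.
Proof. by move=> AB H s us Hs; apply: H => // x /Hs/AB. Qed.

Lemma each_impl P (Q Q' : forall n, system n -> Prop) :
  (forall n S, Q n S -> Q' n S) -> each P Q -> each P Q'.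
Proof. by case: P => [F H E n n0|n n0 F H]; apply: H; auto. Qed.

Lemma post_doorway_starvation :
  entails PostDoorwayBoundedBypass StarvationFreedom.
Proof.
move=> M P _ [f [d]]; apply: each_impl => n S [D H] R HR i a /(H R HR i).
by case=> b [c []]; exists b.
Qed.

Lemma intermittent_starvation :
  entails IntermittentBoundedBypass StarvationFreedom.
Proof.
move=> M P _ [f [h]]; apply: each_impl => n S H R HR i a ia.
by case: (H R HR i) => A [_ /(_ a ia) [b [c []]]]; exists b.
Qed.

Lemma starvation_deadlock : entails StarvationFreedom DeadlockFreedom.
Proof.
move=> M P _; apply: each_impl => n S H R HR t i L.
have [a [at_ ia Hl]] := run_locking_from HR L.
have [b [_ ab Hb Eb]] := H R HR i a ia.
exists b; last by exists i.
rewrite leqNgt; apply/negP => bt; case: Eb => _.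
by rewrite Hl //; lia.
Qed.

Lemma trail_cons n (S : system n) (R : history S) i a t : a < t ->
  trail R i a t.+1 = trail R i a t ++
    (if completes R i t then [:: loc (st R t.+1 i)] else [::]).
Proof.
move=> at_; rewrite /trail /index_iota subSS.
have -> : t - a = (t - a.+1).+1 by lia.
rewrite -[(t - a.+1).+1]addn1 iotaD filter_cat map_cat /= subnKC // .
by case: (completes R i t).
Qed.

Lemma bounded_post_doorway : entails BoundedBypass PostDoorwayBoundedBypass.
Proof.
move=> M P _ [f H]; exists f, (fun=> 1).
(* A trail begins with the initial private state, so size at most 1 means that no action has been
   completed: this doorway is exactly the first instruction. *)
apply: each_impl H => n S H; exists (fun _ l => size l <= 1).
move=> R HR i a ia; have [_ [b [c [Hb Hc Hl]]]] := H R HR i a ia.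
have [ac cc Hmin] := Hc.
have tr u : a < u -> u <= c -> size (trail R i a u) = 1.
  elim: u => // u IH au uc; case: (ltnP a u) => au'; last first.
    by have -> : u = a by [lia]; rewrite /trail /index_iota subnn.
  by rewrite trail_cons // (negPf (Hmin _ _)) ?cats0 ?IH //; lia.
have tr1 : size (trail R i a c.+1) = 2.
  by rewrite trail_cons // cc size_cat tr.
exists b, c; split=> //; last by rewrite tr1.
  by split=> // [u /andP[au uc]|]; [rewrite tr | rewrite tr1].
(* The return that ends [lock] is itself a completed action, so the first completed action cannot
   come after it. *)
rewrite leqNgt; apply/negP => bc; case: Hb => _ ab _ Eb.
have [e1 [_ e3]] := enters_act HR Eb; have := Hmin b.
by rewrite ab bc /completes e1 eqxx e3 (proj1 Eb) => /(_ isT).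
Qed.

Lemma at_most1 (T : eqType) (A : T -> Prop) x :
  (forall y, A y -> y = x) -> at_most 1 A.
Proof.
move=> H [|y [|z s]] //= /and3P[yz _ _] Hs.
have Ey := H y (Hs y (mem_head _ _)).
have Ez := H z (Hs z _); rewrite !inE eqxx orbT in Ez.
by rewrite Ey Ez // inE eqxx in yz.
Qed.

Lemma bounded_intermittent : entails BoundedBypass IntermittentBoundedBypass.
Proof.
move=> M P _ [f H]; exists f, (fun=> 1).
apply: each_impl H => n S H R HR i.
exists (fun j s => j = i /\ exists2 a, invokes R i a & starts_first R i a s).
have first_start a s : invokes R i a -> starts_first R i a s ->
    [/\ exists r, writing R s.+1 i r, ongoing R i s s.+1 & ~~ busy (st R s i)].
  move=> ia Hs; have [c [Hc Ec _]] := starts_first_ex HR ia.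
  rewrite -(starts_first_uniq Hs Hc) in Ec; case: Hs => as_ Hs _ {c Hc}.
  have [[r [v [q Ew]]] _] := H R HR i a ia.
  have L := invokes_locking HR ia.
  have B : st R s.+1 i = PState Locking (loc (st R a i)) true.
    have := pstep_start_write (run_step HR Hs).
    by rewrite Ec L /=; apply=> //; exists r, v, q; rewrite /current /= Ew.
  split; last by rewrite Ec L.
    exists r, v; rewrite /writes B; split=> //; exists q.
    by rewrite /current /= Ew.
  split=> //; first by rewrite Ec L.
  by move=> u Hu; have -> : u = s.+1 by [lia]; rewrite B.
split.
  by move=> j s [-> [a ia /(first_start a s ia)[[r Hr] Ho _]]]; exists r.
move=> a ia; have [_ [b [c [Hb Hc Hl]]]] := H R HR i a ia.
have [s [Hs _ Es]] := starts_first_ex HR ia.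
have [_ os nbs] := first_start a s ia Hs.
have [as_ acts sfirst] := Hs; have [_ ab lk Eb] := Hb.
exists b, s; split=> //.
  (* Only the write at [s] meets the period: one that started earlier would still be going on in
     state [s], where [i] is not busy, and no further [lock] of [i] is invoked before this one
     terminates. *)
  apply: (@at_most1 _ _ (i, s)) => -[j s'] /= [[-> [a' ia' Hs']]].
  case=> u Hu [su nb' bus]; congr (_, _).
  have ss : s <= s'.
    rewrite leqNgt; apply/negP => ss; move: nbs.
    by rewrite bus //; lia.
  have [as' _ sf'] := Hs'.
  have aa : a' <= a.
    rewrite leqNgt; apply/negP => aa; have := lk a'.
    by case: ia' => _ -> /(_ ltac:(lia)).
  have ea : a' = a.
    apply/eqP; rewrite eqn_leq aa leqNgt; apply/negP => aa'.
    by apply: (sf' a); [lia | case: ia].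
  by rewrite ea in Hs'; apply: starts_first_uniq Hs' Hs.
apply: at_most_sub Hl => u [Hu lu nA]; split=> //.
(* A loss up to time [c] falls inside the first write: if the write were over by then, its end would
   be a completed action before [c]. *)
have [su ub] := andP Hu; rewrite ub andbT ltnNge; apply/negP => uc; apply: nA.
exists i, s; split; first by split=> //; exists a.
split=> // v /andP[sv vu]; apply/negPn/negP => nb.
have ex : exists v, (s < v <= u) && ~~ busy (st R v i).
  by exists v; rewrite sv vu nb.
case: (ex_minnP ex) => {nb sv vu}v /andP[Hv nb] Hmin.
case: v Hv nb Hmin => [|v] Hv nb Hmin; first lia.
case: (eqVneq v s) => [ev|vs].
  by case: os => _ _ /(_ v.+1); rewrite (negPf nb) ev !leqnn => /(_ isT).
have Bv : busy (st R v i).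
  by apply/negPn/negP => nbv; have := Hmin v; rewrite nbv; lia.
have Av : act R v == Some i.
  by apply/negPn/negP => /(run_idle HR) E; rewrite E Bv in nb.
have [_ _ /(_ v)] := Hc; rewrite /completes Av nb lk /=; last lia.
by move=> /(_ ltac:(lia)).
Qed.

(** * The bakery algorithm with a prefix *)

Inductive variant := Retry | Once | Countdown.

(* [Door i] is the "choosing" flag of process [i] in the bakery algorithm. *)
Inductive register := Door of 'I_2 | Number of 'I_2.

Inductive pc :=
| Enter | Probe | Delay of nat | Raise | Draw | Post of nat | Lower of nat
| AwaitDoor of nat | AwaitTurn of nat | Win of nat | Clear of nat | Over.

(** In [Countdown] the first write already raises the door, which limits overtaking during the
    count, and [Raise] rewrites the same value. In the other variants the first write repeats the
    value 0. *)
Definition door0 md : nat := if md is Countdown then 1 else 0.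

(* The lexicographic order on pairs (ticket, process); [b] says that the first
   of the two processes is process 0, and the same for all later [b]. *)
Definition before (b : bool) (m w : nat) := if b then m <= w else m < w.

(* A private state that carries [m] belongs to the ticket [m.+1], 0 being the
   ticket of a process that does not compete; so reading [w.+1] in [AwaitTurn]
   means that the other process has reached a state that carries [w]. *)
Definition code md (i : 'I_2) (p : pc) : instr (fun _ : register => nat) pc :=
  match p with
  | Enter => @Write _ (fun=> nat) _ (Door i) (door0 md) Probe
  | Probe => @Read _ (fun=> nat) _ (Number (rev_ord i)) (fun v => match md with
      | Retry => if v is 0 then Raise else Probe
      | Once => Raise
      | Countdown => Delay v
      end)
  | Delay k => Local (if k is k'.+1 then Delay k' else Raise)
  | Raise => @Write _ (fun=> nat) _ (Door i) 1 Draw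
  | Draw => @Read _ (fun=> nat) _ (Number (rev_ord i)) (fun v => Post v)
  | Post m => @Write _ (fun=> nat) _ (Number i) m.+1 (Lower m)
  | Lower m => @Write _ (fun=> nat) _ (Door i) 0 (AwaitDoor m)
  | AwaitDoor m => @Read _ (fun=> nat) _ (Door (rev_ord i))
      (fun v => if v is 0 then AwaitTurn m else AwaitDoor m)
  | AwaitTurn m => @Read _ (fun=> nat) _ (Number (rev_ord i)) (fun v =>
      if v is w.+1 then if before (i == ord0) m w then Win m else AwaitTurn m
      else Win m)
  | Win m => Return (Clear m)
  | Clear m => @Write _ (fun=> nat) _ (Number i) 0 Over
  | Over => Return Enter
  end.

Definition bakery md : system 2 :=
  @System 2 register (fun=> nat) (fun=> 0) pc (fun=> Enter) (code md) (code md).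

(* A copy of [pstate (bakery md)] whose type does not mention [md], which can
   therefore be analyzed by cases. *)
Record phase := Phase { part : sect; at_pc : pc; acting : bool }.

Definition phase_of md (x : pstate (bakery md)) : phase :=
  Phase (sec x) (loc x) (busy x).

(** * The abstract two-process system and its invariant *)

Section Abstract.

Variable md : variant.

Implicit Types x y : phase.

Definition door (p : pc) : nat :=
  match p with
  | Probe | Delay _ | Raise => door0 md
  | Draw | Post _ | Lower _ => 1
  | _ => 0
  end.

Definition ticket (p : pc) : nat :=
  match p with
  | Lower m | AwaitDoor m | AwaitTurn m | Win m | Clear m => m.+1
  | _ => 0
  end.

Definition at_door_write p :=
  if p is (Enter | Raise | Lower _) then true else false.
Definition at_number_write p :=
  if p is (Post _ | Clear _) then true else false.
Definition at_door_read p := if p is AwaitDoor _ then true else false.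
Definition at_number_read p :=
  if p is (Probe | Draw | AwaitTurn _) then true else false.

(* A read of [x] is dirty ([dx]) if it has clashed with a write since it
   started; a clean read returns a value that is determined by the program
   counter of the other process. *)
Definition clash x y := [&& acting x, acting y &
  at_door_read (at_pc x) && at_door_write (at_pc y) ||
  at_number_read (at_pc x) && at_number_write (at_pc y)].

(** A step as a function: [b] tells whether the process is process 0, and all nondeterminism is
    confined to [v], the value returned if the step terminates a read. *)
Definition advance (b : bool) x (v : nat) : phase :=
  match part x with
  | Remainder => Phase Locking (at_pc x) false
  | Critical => Phase Unlocking (at_pc x) false
  | s => match code md (if b then ord0 else ord_max) (at_pc x) with
    | Read _ k =>
      if acting x then Phase s (k v) false else Phase s (at_pc x) true
    | Write _ _ q =>
      if acting x then Phase s q false else Phase s (at_pc x) true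
    | Local q => Phase s q false
    | Return q => Phase (if s is Locking then Critical else Remainder) q false
    end
  end.

Definition wf x :=
  match part x, at_pc x with
  | Remainder, Enter | Critical, Clear _ | Locking, (Delay _ | Win _)
  | Unlocking, Over => ~~ acting x
  | Unlocking, Clear _ => true
  | Locking, (Clear _ | Over) => false
  | Locking, _ => true
  | _, _ => false
  end.

Definition legal x (dx : bool) y v :=
  acting x && ~~ dx ==>
  (at_door_read (at_pc x) ==> (v == door (at_pc y))) &&
  (at_number_read (at_pc x) ==> (v == ticket (at_pc y))).

(** A dirty access stays dirty until it terminates, and a process that is not acting is never
    dirty. *)
Definition redirty x (dx : bool) x' y' :=
  acting x' && (clash x' y' || acting x && dx).

(* [y] cannot enter before a process waiting with ticket [m.+1]: it has a later
   ticket, or is bound to draw one. *)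
Definition behind b m y (dy : bool) :=
  match at_pc y with
  | Draw => acting y ==> ~~ dy
  | Post w => m < w
  | Lower w | AwaitDoor w | AwaitTurn w | Win w => before b m w
  | Clear w => if part y is Critical then before b m w else true
  | _ => true
  end.

Definition posted y :=
  match at_pc y with
  | Lower _ | AwaitDoor _ | AwaitTurn _ | Win _ => true
  | Clear _ => if part y is Critical then true else false
  | _ => false
  end.

Definition lowering y :=
  posted y && (if at_pc y is Lower _ then acting y else true).

Definition door_up y :=
  match at_pc y with
  | Draw | Post _ => true
  | Lower _ => ~~ acting y
  | _ => false
  end.

(** Lamport's ordering argument in inductive form. A door read that may let [x] pass requires that
    [y] is behind, or that its ticket is already written, so that the next read will see it; in the
    remaining case a clean read finds the door up and returns 1. In [AwaitTurn], unless [y] is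
    behind, the ticket of [y] is written and is read cleanly. *)
Definition order_inv b x (dx : bool) y (dy : bool) :=
  match at_pc x with
  | AwaitDoor m => acting x ==>
     [|| behind b m y dy, lowering y | ~~ dx && door_up y]
  | AwaitTurn m =>
     behind b m y dy || posted y && (acting x ==> ~~ dx)
  | Win m => behind b m y dy
  | Clear m => if part x is Critical then behind b m y dy else true
  | _ => true
  end.

Definition coherent b x dx y dy := [&& wf x, wf y, clash x y ==> dx,
  clash y x ==> dy, order_inv b x dx y dy & order_inv (~~ b) y dy x dx].

Lemma coherent_sym b x dx y dy : coherent b x dx y dy -> coherent (~~ b) y dy x dx.
Proof. by rewrite /coherent negbK => /and5P[-> -> -> -> /andP[-> ->]]. Qed.

Ltac simp := rewrite /= ?(implybT, implyTb, andbT, andbF, orbT, orbF, andTb).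

Ltac split_vars := simp; try done; try match goal with
  | |- context [match ?e with _ => _ end] => is_var e;
    lazymatch type of e with
    | variant => case: e
    | _ => case: e => [|?]
    end; split_vars
  | |- context [if ?c then _ else _] =>
    lazymatch c with context [match _ with _ => _ end] => fail
    | context [if _ then _ else _] => fail
    | _ => let E := fresh "E" in case E: c; split_vars end
  end.

Lemma eq_ord_of_bool b : ((if b then ord0 else ord_max) == ord0 :> 'I_2) = b.
Proof. by case: b. Qed.

(** Exhaustive check over the control positions of both processes; tickets stay symbolic, and their
    comparisons are linear arithmetic. Steps of [y] follow through [coherent_sym]. *)
Lemma coherent_step b x dx y dy v : coherent b x dx y dy -> legal x dx y v ->
  let x' := advance b x v in
  coherent b x' (redirty x dx x' y) y (redirty y dy y x').
Proof.
case: x => [[] [||[|k]|||m|m|m|m|m|m|] []] /= /[dup] /and3P[// _ wy _];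
move: y wy => [[] [||k'|||m'|m'|m'|m'|m'|m'|] []] // _;
 rewrite /coherent /legal /redirty /advance /order_inv /lowering /behind /posted
   /door_up /clash /wf /before /= ?eq_ord_of_bool /=; try done.
all: simp; try done.
all: split_vars.
all: by move=> *; simpl in *; lia.
Qed.

(** * Liveness and overtaking as properties of single steps *)

(** Each of two processes in the critical section would have the other one behind it, against the
    asymmetry of the order on pairs of ticket and process. *)
Lemma coherent_exclusion b x dx y dy : coherent b x dx y dy ->
  part x = Critical -> part y = Critical -> False.
Proof.
case: x => [[] [||k|||m|m|m|m|m|m|] []] //;
case: y => [[] [||k'|||m'|m'|m'|m'|m'|m'|] []] //.
by case: b; rewrite /coherent /order_inv /behind /before /=; lia.
Qed.

(* The number of steps of [x] until it enters is not bounded, as it may have to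
   wait for [y]; so each state designates a helper whose next step decreases a
   lexicographic rank, while the other process does not increase it.  While [x]
   waits, [y] makes at most two laps: one with an earlier ticket (or one drawn
   by a dirty read), the second one behind [x]. *)
Definition own_rank x :=
  match at_pc x with
  | Enter => 61 | Probe => 59 | Delay _ => 57 | Raise => 55 | Draw => 53
  | Post _ => 51 | _ => 49
  end - acting x.

(** A dirty read ranks above the state before a read, because it may return a value that makes
    another read necessary. *)
Definition wait_rank x (dx : bool) :=
  match at_pc x with
  | AwaitDoor _ => if acting x then if dx then 6 else 4 else 5
  | _ => if acting x then if dx then 4 else 2 else 3
  end.

(** Values from 29 on belong to the lap that [y] makes ahead of [x], those up to 26 to the lap that
    ends behind [x]. All are below 48, the least value of [own_rank], so that the rank drops when
    [x] starts to wait. *)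
Definition other_rank b m y (dy : bool) :=
  if behind b m y dy then
    match at_pc y with
    | Clear _ => 26 - acting y
    | Over => 24
    | Enter => if part y is Remainder then 23 else 22 - acting y
    | Probe => 20 - (if md is Retry then 0 else acting y)
    | Delay _ => 18
    | Raise => 17 - acting y
    | Draw => 15 - acting y
    | Post _ => 13 - acting y
    | Lower _ => 11 - acting y
    | _ => 5
    end
  else
    match at_pc y with
    | Post _ => 46 - acting y
    | Lower _ => 44 - acting y
    | AwaitDoor _ => 35 + wait_rank y dy
    | AwaitTurn _ => 35 + wait_rank y dy
    | Win _ => 30
    | Clear _ => 29
    | _ => 47
    end.

(** Here [y] is idle or itself waits for [x], so [x] has to make the next useful step; as [y] is not
    writing, reads that [x] starts now begin clean. *)
Definition helps b m y (dy : bool) := behind b m y dy &&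
  match at_pc y with
  | Enter => if part y is Remainder then true else false
  | Probe => if md is Retry then true else false
  | AwaitDoor _ | AwaitTurn _ => true
  | _ => false
  end.

Definition helper b x y dy :=
  match at_pc x with
  | AwaitDoor m | AwaitTurn m => helps b m y dy
  | _ => true
  end.

Definition rank b x dx y dy : nat * nat :=
  match at_pc x with
  | AwaitDoor m | AwaitTurn m => (other_rank b m y dy,
      if helps b m y dy then wait_rank x dx
      else if at_pc y is Delay k then k else 0)
  | Delay k => (own_rank x, k)
  | _ => (own_rank x, 0)
  end.

Definition lex (r r' : nat * nat) :=
  (r.1 < r'.1) || (r.1 == r'.1) && (r.2 < r'.2).

Definition competing x := if part x is Locking then
  match at_pc x with
  | Enter | Probe => if md is Retry then false else true
  | Win _ => false
  | _ => true
  end else false.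

Definition winning x :=
  if part x is Locking then if at_pc x is Win _ then true else false else false.

(** The flag [h] says that the helper is [x]. A step may leave the rank unchanged only if it is not
    a step of the helper, and then the helper stays the same. *)
Definition progress (i_acts : bool) r (h : bool) r' (h' : bool) :=
  lex r' r || (r' == r) && (h' == h) && (h == ~~ i_acts).

Definition rank_progress b (i_acts : bool) x dx y dy x' dx' y' dy' :=
  progress i_acts (rank b x dx y dy) (helper b x y dy)
    (rank b x' dx' y' dy') (helper b x' y' dy').

Lemma helper_active b x dx y dy : coherent b x dx y dy ->
  ~~ helper b x y dy -> part y <> Remainder.
Proof.
case/and3P=> _ wy _; rewrite /helper /helps /behind.
by case: y wy => [[] [||k'|||m'|m'|m'|m'|m'|m'|] []] //= _; case: (at_pc x).
Qed.

Lemma other_rank_lt b m y dy : other_rank b m y dy < 48.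
Proof.
rewrite /other_rank /wait_rank; case: (behind _ _ _ _); case: (at_pc y) => //;
  case: (part y); case: (acting y); case: dy => //; case: (md) => //.
Qed.

Lemma behind_redirty b m y dy : behind b m y (acting y && dy) = behind b m y dy.
Proof. by rewrite /behind; case: (at_pc y) => //; case: (acting y). Qed.

Lemma other_rank_redirty b m y dy :
  other_rank b m y (acting y && dy) = other_rank b m y dy.
Proof.
by rewrite /other_rank behind_redirty /wait_rank; case: (acting y).
Qed.

Lemma waiting_redirty x dx y m : at_pc x = AwaitDoor m \/ at_pc x = AwaitTurn m ->
  redirty y dx y x = acting y && dx.
Proof.
rewrite /redirty /clash => -[] ->; rewrite !andbF /=; by case: (acting y).
Qed.

Lemma own_rank_step b x dx y dy v : wf x -> competing x ->
  (forall m, at_pc x <> AwaitDoor m /\ at_pc x <> AwaitTurn m) ->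
  let x' := advance b x v in
  competing x' && lex (rank b x' (redirty x dx x' y) y (redirty y dy y x'))
       (rank b x dx y dy).
Proof.
move=> wx cx nw; have nd m := (nw m).1; have nt m := (nw m).2.
have lt48 m d := leq_trans (other_rank_lt b m y d) (_ : _ <= _).
move: nd nt wx cx => {nw}; case: x => [[] [||[|k]|||m|m|m|m|m|m|] []] //= nd nt _;
  rewrite /competing /lex /rank /own_rank /=;
  try by [case: (nd m) | case: (nt m)].
all: try (by case: (md)).
all: try by rewrite ?lt48 ?orbT.
Qed.

Lemma helps_step b x dx y dy v m : coherent b x dx y dy ->
  part x = Locking -> at_pc x = AwaitDoor m \/ at_pc x = AwaitTurn m ->
  helps b m y dy -> legal x dx y v ->
  let x' := advance b x v in
  winning x' ||
   [&& (if at_pc x' is (AwaitDoor m' | AwaitTurn m') then m' == m else false) &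
    wait_rank x' (redirty x dx x' y) < wait_rank x dx].
Proof.
case: x => s p bx /= C Es Ep; move: Es Ep C => -> [] ->; case: bx;
case: y => [[] [||k'|||m'|m'|m'|m'|m'|m'|] []] /= /and3P[// _ _ _];
 rewrite /legal /redirty /advance /behind /clash /before /= ?eq_ord_of_bool /helps
   /wait_rank /winning /behind /before /door0 /= ?eqxx; try done.
all: simp; try done.
all: split_vars.
all: by move=> *; simpl in *; lia.
Qed.

Lemma rank_step b x dx y dy v : coherent b x dx y dy -> competing x ->
  legal x dx y v ->
  let x' := advance b x v in
  winning x' || competing x' &&
    rank_progress b true x dx y dy x' (redirty x dx x' y) y (redirty y dy y x').
Proof.
move=> C cx L /=; set x' := advance b x v.
have Lx : part x = Locking by move: cx; rewrite /competing; case: (part x).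
have wx : wf x by case/and3P: C.
have [[m Em]|nw] : (exists m, at_pc x = AwaitDoor m \/ at_pc x = AwaitTurn m) \/
    (forall m, at_pc x <> AwaitDoor m /\ at_pc x <> AwaitTurn m).
  by case: (at_pc x) => [||k|||m|m|m|m|m|m|]; try (by right); left; exists m; auto.
- have [w|nw] := boolP (winning x') => //=.
  have [cx' Em'] : competing x' /\ (at_pc x' = AwaitDoor m \/ at_pc x' = AwaitTurn m).
    move: nw Em wx Lx; rewrite /x' /advance.
    case: x {C L cx x'} => s p [] /= nw Em wx Es; move: nw Em;
      rewrite /winning /competing Es => nw [] Ep; move: nw; rewrite Ep /=;
      case: v => [|w] /=; auto; case: before => //; auto.
  have ry : redirty y dy y x' = acting y && dy by apply: waiting_redirty Em'.
  rewrite /rank_progress /progress ry cx' /=.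
  have Rk z d e : at_pc z = AwaitDoor m \/ at_pc z = AwaitTurn m ->
     rank b z d y e = (other_rank b m y e, if helps b m y e then wait_rank z d
       else if at_pc y is Delay k then k else 0).
    by rewrite /rank => -[] ->.
  have Hk z e : at_pc z = AwaitDoor m \/ at_pc z = AwaitTurn m ->
     helper b z y e = helps b m y e.
    by rewrite /helper => -[] ->.
  rewrite !Rk // !Hk // other_rank_redirty /helps behind_redirty -/(helps b m y dy).
  rewrite /lex /= ltnn eqxx /=.
  have [h|h] := boolP (helps b m y dy); last by rewrite eqxx orbT.
  have /= := helps_step C Lx Em h L; rewrite -/x' (negPf nw) /=.
  by case/andP=> _ ->.
- have /= := @own_rank_step b x dx y dy v wx cx nw; rewrite -/x' => /andP[-> l].
  by rewrite /rank_progress /progress l /= orbT.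
Qed.

Lemma rank_other_step b x dx y dy v : coherent b x dx y dy -> competing x ->
  legal y dy x v ->
  let y' := advance (~~ b) y v in
  rank_progress b false x dx y dy x (redirty x dx x y') y' (redirty y dy y' x).
Proof.
move=> C cx L /=; set y' := advance (~~ b) y v.
have Lx : part x = Locking by move: cx; rewrite /competing; case: (part x).
have wx : wf x by case/and3P: C.
have [[m Em]|nw] : (exists m, at_pc x = AwaitDoor m \/ at_pc x = AwaitTurn m) \/
    (forall m, at_pc x <> AwaitDoor m /\ at_pc x <> AwaitTurn m).
  by case: (at_pc x) => [||k|||m|m|m|m|m|m|]; try (by right); left; exists m; auto.
- move: C cx L; rewrite /y' {y'}; move: Em Lx wx.
  case: x => s p bx /= Ep Es; move: Es Ep => -> Ep _.
  case: y => [[] [||[|k']|||m'|m'|m'|m'|m'|m'|] []] /= /and3P[_ // _] + _;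
  case: Ep => ->; case: bx;
 rewrite /legal /redirty /advance /order_inv /lowering /behind /posted
   /door_up /clash /before /= ?eq_ord_of_bool /rank_progress /progress /rank
    /helper /helps
   /other_rank /wait_rank /lex /behind /before /door0 /= ?eqxx;
  simp; try done.
all: split_vars.
all: move=> *; simpl in *; try lia.
- rewrite /rank_progress /progress /helper /rank; move: nw cx; rewrite /competing.
by case: (at_pc x) => [||k|||m|m|m|m|m|m|] nw; rewrite /= ?eqxx ?orbT //; case: (nw m).
Qed.

(** * Leaving the prefix when no process is beyond it *)

Definition approaching x := if part x is Locking then
  if at_pc x is (Enter | Probe) then true else false else false.

Definition advanced x := if part x is Locking then
  if at_pc x is (Enter | Probe) then false else true else false.

(** First [y] runs through [unlock]; afterwards its ticket is 0 and is not being written, so one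
    clean read takes [x] out of the prefix. *)
Definition probe_rank x (dx : bool) y : nat * nat :=
  if at_pc x is Enter then (40 - acting x, 0) else
  (match at_pc y with
   | Clear _ => if part y is Critical then 28 else 27 - acting y
   | Over => 25
   | Enter => if part y is Remainder then 24 else 23 - acting y
   | Probe => 20
   | _ => 0
   end,
   if part y is (Remainder | Locking) then
     if acting x then if dx then 3 else 1 else 2 else 0).

Definition probe_helper x y :=
  if at_pc x is Enter then true else
  if part y is (Remainder | Locking) then true else false.

Definition probe_progress i_acts x dx y x' dx' y' :=
  progress i_acts (probe_rank x dx y) (probe_helper x y)
    (probe_rank x' dx' y') (probe_helper x' y').

Lemma probe_step b x dx y dy v : coherent b x dx y dy ->
  approaching x -> ~~ advanced y -> legal x dx y v ->
  let x' := advance b x v in advanced x' || approaching x' &&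
    probe_progress true x dx y x' (redirty x dx x' y) y.
Proof.
case/and3P=> wx wy; case: x wx => [[] [||[|k]|||m|m|m|m|m|m|] []] // _;
case: y wy => [[] [||[|k']|||m'|m'|m'|m'|m'|m'|] []] // _;
  rewrite /approaching /advanced /=; try done;
 rewrite /legal /redirty /advance /clash /probe_progress /progress /probe_rank
    /probe_helper /lex /door0 /advanced /approaching /=; split_vars.
all: by move=> *; simpl in *; lia.
Qed.

Lemma probe_other_step b x dx y dy v : coherent b x dx y dy ->
  approaching x -> ~~ advanced y ->
  let y' := advance (~~ b) y v in advanced y' ||
    probe_progress false x dx y x (redirty x dx x y') y'.
Proof.
case/and3P=> wx wy; case: x wx => [[] [||[|k]|||m|m|m|m|m|m|] []] // _;
case: y wy => [[] [||[|k']|||m'|m'|m'|m'|m'|m'|] []] // _;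
  rewrite /redirty /advance /clash /probe_progress /progress /probe_rank
    /probe_helper /lex /door0 /advanced /approaching /=; split_vars.
all: by move=> *; simpl in *; lia.
Qed.

Lemma probe_helper_active x y : ~~ probe_helper x y ->
  part y <> Remainder.
Proof. by rewrite /probe_helper; case: (at_pc x); case: (part y). Qed.

(* [credit] bounds the number of times that [y] can still overtake [x] outside
   the [covered] writes. *)
Definition past_door y (dy : bool) : nat :=
  if part y is Locking then match at_pc y with
  | AwaitDoor _ => acting y && dy
  | AwaitTurn _ | Win _ => true
  | _ => false
  end else false.

(** A process in the critical section has already been counted as overtaking, hence the 0. *)
Definition ahead b m y (dy : bool) : nat :=
  if part y is Critical then 0 else ~~ behind b m y dy.

Definition credit b x y (dy : bool) : nat :=
  match at_pc x with
  | Enter => 3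
  | Raise => 2 + (if acting x then 0 else past_door y dy)
  | Probe | Delay _ => 2 + past_door y dy
  | Draw | Post _ => 1 + past_door y dy
  | Lower m => if acting x then ahead b m y dy else 1 + past_door y dy
  | AwaitDoor m | AwaitTurn m | Win m => ahead b m y dy
  | _ => 0
  end.

Definition at_cover (p : pc) := if p is (Enter | Raise) then true else false.

Definition covered x := acting x && at_cover (at_pc x).

(** Losses are bounded from [Draw] on, and for [Countdown] from the start of the first write on,
    since there the door is up or is being written by a covered write. *)
Definition counted x := if part x is Locking then
  match at_pc x with
  | Enter => if md is Countdown then acting x else false
  | Probe | Delay _ | Raise => if md is Countdown then true else false
  | _ => true
  end else false.

Lemma past_door1 y dy : past_door y dy <= 1.
Proof.
by rewrite /past_door; case: (part y) (at_pc y) => // -[] //= _; case: (_ && _).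
Qed.

Lemma credit_step b x dx y dy v : coherent b x dx y dy -> counted x ->
  let x' := advance b x v in
  (credit b x' y (redirty y dy y x') <= credit b x y dy) &&
  (if part x' is Locking then counted x' else true).
Proof.
case/and3P=> wx wy; case: x wx => [[] [||[|k]|||m|m|m|m|m|m|] []] // _;
case: y wy => [[] [||[|k']|||m'|m'|m'|m'|m'|m'|] []] // _;
  rewrite /legal /redirty /advance /clash /counted /=; try done;
 rewrite /credit /past_door /ahead
   /order_inv /behind /posted /lowering /door_up /before /=; split_vars.
all: by move=> *; simpl in *; lia.
Qed.

(** While the door of [x] is up and not being written, [y] can enter only if it is already past the
    door; one further entry is reserved for an earlier ticket, and before [Raise] one more for
    passing the door during that write. Entries during a covered write, where dirty reads can let
    [y] pass again and again, are not charged. *)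
Lemma credit_other_step b x dx y dy v : coherent b x dx y dy -> counted x ->
  legal y dy x v ->
  let y' := advance (~~ b) y v in
  credit b x y' (redirty y dy y' x) +
    ((if part y is Locking then if part y' is Critical then true else false
      else false) && ~~ covered x)
    <= credit b x y dy.
Proof.
case/and3P=> wx wy; case: x wx => [[] [||[|k]|||m|m|m|m|m|m|] []] // _;
case: y wy => [[] [||[|k']|||m'|m'|m'|m'|m'|m'|] []] // _;
  rewrite /legal /redirty /advance /clash /counted /=; try done;
 rewrite /credit /past_door /ahead
   /order_inv /behind /posted /lowering /door_up /before /door /door0 /=
   ?eq_ord_of_bool; split_vars.
all: by move=> *; simpl in *; lia.
Qed.
End Abstract.

Ltac case_before := try match goal with
  | |- context [before ?b ?m ?w] => case: (before b m w)
  end.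

(** * Runs of the bakery algorithm *)

Lemma busy_ongoing n (S : system n) (R : history S) i t :
  ~~ busy (st R 0 i) -> busy (st R t i) -> exists s, ongoing R i s t.
Proof.
move=> nb0; elim: t => [|t IH]; first by rewrite (negPf nb0).
case b: (busy (st R t i)) => bt.
  have [s os] := IH b; exists s; case: os => st_ nb H; split=> //; first lia.
  move=> u Hu; case: (ltngtP u t.+1) => ut; [apply: H | | rewrite ut //]; lia.
exists t; split=> //; first by rewrite b.
by move=> u Hu; have -> : u = t.+1 by lia.
Qed.

Section BakeryRuns.

Variables (md : variant) (R : history (bakery md)).
Hypothesis HR : run R Safe.

Notation o := (@rev_ord 2).

Definition first (i : 'I_2) := i == ord0.

Lemma first_rev i : first (o i) = ~~ first i.
Proof. by case: i => -[|[|]]. Qed.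

Lemma ord_of_first i : (if first i then ord0 else ord_max) = i :> 'I_2.
Proof. by apply: val_inj; case: i => -[|[|]]. Qed.

Lemma ord2P (i j : 'I_2) : j = i \/ j = o i.
Proof.
by case: i j => -[|[|]] // ? [[|[|]] // ?]; [left|right|right|left]; apply: val_inj.
Qed.

Lemma rev_neq i : o i <> i.
Proof. by case: i => -[|[|]] // ? []. Qed.

Definition ph t i := phase_of (st R t i).

Fixpoint dirty t i := if t is t'.+1 then
  redirty (ph t' i) (dirty t' i) (ph t i) (ph t (o i)) else false.

Lemma currentE i (x : pstate (bakery md)) ins : current i x = Some ins ->
  code md i (loc x) = ins /\ (sec x = Locking \/ sec x = Unlocking).
Proof. by case: x => -[] p b //= [<-]; auto. Qed.

(** Every step of a run is an abstract step. That the value is legal is shown in [own_move], once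
    the contents of the registers are known. *)
Lemma run_advance t i : act R t = Some i ->
  exists v, ph t.+1 i = advance md (first i) (ph t i) v /\
    if code md i (loc (st R t i)) is Read r _ then
      busy (st R t i) -> @read_result _ _ R Safe i t r v else True.
Proof.
move/(run_step HR); rewrite /ph; case.
- by move=> p; exists 0; split=> //=; case: code.
- by move=> p; exists 0; split=> //=; case: code.
- move=> s p r k /currentE /= [E Hs]; exists 0.
  by rewrite /advance /phase_of /= ord_of_first E; case: Hs => ->.
- move=> s p r v q /currentE /= [E Hs]; exists 0.
  by rewrite /advance /phase_of /= ord_of_first E; case: Hs => ->.
- move=> s p r k v /currentE /= [E Hs] H; exists v.
  by rewrite /advance /phase_of /= ord_of_first E; case: Hs => ->.
- move=> s p r v q /currentE /= [E Hs]; exists 0.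
  by rewrite /advance /phase_of /= ord_of_first E; case: Hs => ->.
- move=> s p q /currentE /= [E Hs]; exists 0.
  by rewrite /advance /phase_of /= ord_of_first E; case: Hs => ->.
- move=> p q /currentE /= [E Hs]; exists 0.
  by rewrite /advance /phase_of /= ord_of_first E.
- move=> p q /currentE /= [E Hs]; exists 0.
  by rewrite /advance /phase_of /= ord_of_first E.
Qed.

Definition owner r := match r with Door i | Number i => i end.
Definition at_write r p :=
  match r with Door _ => at_door_write p | Number _ => at_number_write p end.
Definition value r p :=
  match r with Door _ => door md p | Number _ => ticket p end.

Lemma writesE t i r v : @writes _ _ R t i r v ->
  [/\ i = owner r, acting (ph t i), at_write r (at_pc (ph t i)) &
   exists q, code md i (loc (st R t i)) = Write r v q].
Proof.
case=> b [q /currentE[E _]]; suff [eo ew] : i = owner r /\ at_write r (loc (st R t i)).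
  by split=> //; exists q.
by move: E; case: (loc _) => //= > [<-].
Qed.

Lemma writingE t i r : writing R t i r ->
  [/\ i = owner r, acting (ph t i) & at_write r (at_pc (ph t i))].
Proof. by case=> v /writesE[]. Qed.

Lemma act_busy t i : act R t = Some i -> busy (st R t i) ->
  busy (st R t.+1 i) = false.
Proof. by move/(run_step HR); case. Qed.

Lemma ongoing_state i s t u : ongoing R i s t -> s < u <= t ->
  st R u i = st R t i.
Proof.
case=> st_ _ H Hu; symmetry; apply: (run_idle_until HR); first lia.
move=> v Hv; apply/negP => /eqP /act_busy.
by rewrite !H; [move=> /(_ isT) | lia | lia].
Qed.

Lemma busy_run_ongoing t i : busy (st R t i) -> exists s, ongoing R i s t.
Proof. by apply: busy_ongoing; case: HR => ->. Qed.

Lemma busy_current t i : busy (st R t i) ->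
  current i (st R t i) = Some (code md i (loc (st R t i))).
Proof.
elim: t => [|t IH]; first by case: HR => ->.
have [/(run_step HR)|/(run_idle HR) ->//] := eqVneq (act R t) (Some i).
by case=> //= s p > /currentE /= [_ []] ->.
Qed.

Lemma clean_ongoing i s t u : ongoing R i s t -> ~~ dirty t i -> s < u <= t ->
  ~~ clash (ph u i) (ph u (o i)).
Proof.
move=> [st_ _]; elim: t st_ u => [|t IH] // st_ u Hb.
have b : busy (st R t.+1 i) by apply: Hb; lia.
rewrite /= /redirty [acting (ph t.+1 i)]b /= negb_or => /andP[nc nd] Hu.
case: (ltngtP u t.+1) => ut; [|lia|by rewrite ut].
apply: IH => //; [lia | by move=> w Hw; apply: Hb; lia | | lia].
by move: nd; rewrite /ph /= Hb //; lia.
Qed.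

Lemma value_advance b x v r : ~~ (acting x && at_write r (at_pc x)) ->
  value r (at_pc (advance md b x v)) = value r (at_pc x).
Proof.
case: x => s p bx; rewrite /advance; case: s => //=;
  case: p => [||[|k]|||m|m|m|m|m|m|]; case: bx; case: r => j //=;
  case: (md); case: v => [|v] //=; case_before => //.
Qed.

Lemma nonatomic : nonatomic_content R.
Proof. by case: HR => _ _ []. Qed.

(** Only its owner writes a register, so writes on it never overlap, and between writes it holds the
    last value written, which the program counter of the owner determines. *)
Lemma content_value t r :
  ~~ (acting (ph t (owner r)) && at_write r (at_pc (ph t (owner r)))) ->
  content R t r = value r (at_pc (ph t (owner r))).
Proof.
have [keep last] := nonatomic.
elim: t => [|t IH].
  by case: HR => H0 _ [Hc _] _ _; rewrite Hc /ph H0; case: r.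
set i := owner r in IH *; move=> nw.
have [/andP[b w]|nw'] := boolP (acting (ph t i) && at_write r (at_pc (ph t i))).
  have [e|/(run_idle HR) E] := eqVneq (act R t) (Some i); last first.
    by move: nw; rewrite /ph E; rewrite /ph in b w; rewrite b w.
  have [s os] := busy_run_ongoing b.
  have [v [q [E Ev]]] : exists v q,
      code md i (loc (st R t i)) = Write r v q /\ value r q = v.
    move: w; rewrite /ph /i /=; case: (r) => j /=;
    by case: (loc _) => //= *; eexists; eexists; (split; first reflexivity).
  have Ew : @writes _ _ R t i r v.
    by split; [exact: b | exists q; rewrite (busy_current b) E].
  rewrite (last s t i r v os e Ew); last first.
    by move=> u j Hu nj /writingE[].
  have [w' [-> _]] := run_advance e.
  have b' : busy (st R t i) := b.
  have := busy_current b; rewrite /current /advance /= ord_of_first E b'.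
  by case: (sec _).
rewrite keep ?IH //; last by move=> j /writingE[-> b w]; rewrite b w in nw'.
have [e|/(run_idle HR) E] := eqVneq (act R t) (Some i); last by rewrite /ph E.
by have [w' [-> _]] := run_advance e; rewrite value_advance.
Qed.

Lemma clean_read t i r v : @read_result _ _ R Safe i t r v ->
  ~~ dirty t i -> owner r = o i ->
  (match r with Door _ => at_door_read | Number _ => at_number_read end)
    (at_pc (ph t i)) ->
  v = value r (at_pc (ph t (o i))).
Proof.
case=> s os Hs nd Er Hr.
have nw u j : s < u <= t -> ~ writing R u j r.
  move=> Hu /writingE[-> b w]; have /negP := clean_ongoing os nd Hu; apply.
  have bi : busy (st R u i) by case: os => _ _; apply.
  rewrite /clash -Er b [acting _]bi /= /ph (ongoing_state os Hu).
  by move: Hr w; rewrite /ph; case: (r) => j' /= -> ->; rewrite ?orbT.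
rewrite Hs; last by move=> u j; apply: nw.
have st_ : s < t by case: os.
rewrite content_value Er //; apply/negP => /andP[b w].
apply: (nw t (o i)); first lia.
have [w' [q E]] : exists v q, code md (o i) (loc (st R t (o i))) = Write r v q.
  move: w; rewrite /ph -Er; case: (r) => j /=;
    by case: (loc _) => //= *; eexists; eexists; reflexivity.
by exists w'; split; [exact: b | exists q; rewrite busy_current // E].
Qed.

Variant move t i : Prop :=
| NoMove of ph t.+1 i = ph t i & ph t.+1 (o i) = ph t (o i)
    & dirty t.+1 i = dirty t i & dirty t.+1 (o i) = dirty t (o i)
    & act R t = None
| OwnMove v of act R t = Some i
    & legal md (ph t i) (dirty t i) (ph t (o i)) v
    & ph t.+1 i = advance md (first i) (ph t i) v
    & ph t.+1 (o i) = ph t (o i)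
| OtherMove v of act R t = Some (o i)
    & legal md (ph t (o i)) (dirty t (o i)) (ph t i) v
    & ph t.+1 (o i) = advance md (~~ first i) (ph t (o i)) v
    & ph t.+1 i = ph t i.

Definition run_coherent t i :=
  coherent (first i) (ph t i) (dirty t i) (ph t (o i)) (dirty t (o i)).

Lemma own_move t i : act R t = Some i ->
  exists v, [/\ legal md (ph t i) (dirty t i) (ph t (o i)) v,
    ph t.+1 i = advance md (first i) (ph t i) v & ph t.+1 (o i) = ph t (o i)].
Proof.
move=> e; have [v [Ev Hv]] := run_advance e; exists v; split=> //; last first.
  rewrite /ph (run_idle HR) // e; apply/eqP => -[] /esym/rev_neq //.
apply/implyP => /andP[b nd]; have nd' := nd.
apply/andP; split; apply/implyP => Hr; apply/eqP.
  apply: (@clean_read t i (Door (o i))) => //.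
  by move: Hr Hv b; rewrite /ph /=; case: (loc _) => //= m _ H /H.
apply: (@clean_read t i (Number (o i))) => //.
by move: Hr Hv b; rewrite /ph /=; case: (loc _) => //= > _ H /H.
Qed.

Lemma dirty_step t i : dirty t.+1 i =
  redirty (ph t i) (dirty t i) (ph t.+1 i) (ph t.+1 (o i)).
Proof. by []. Qed.

Lemma dirty_acting t i : dirty t i -> acting (ph t i).
Proof. by case: t => // t; rewrite dirty_step => /andP[]. Qed.

Lemma moveP t i : run_coherent t i -> move t i.
Proof.
move=> C; case e: (act R t) => [j|].
  case: (ord2P i j) => Ej; rewrite Ej in e; have [v [L E E']] := own_move e.
    by apply: OwnMove e L E E'.
  by rewrite rev_ordK first_rev in L E E'; apply: OtherMove e L E E'.
have E j : ph t.+1 j = ph t j by rewrite /ph (run_idle HR) // e.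
have D j : clash (ph t j) (ph t (o j)) ==> dirty t j -> dirty t.+1 j = dirty t j.
  rewrite dirty_step !E /redirty => /implyP c.
  apply/andP/idP => [[b /orP[/c|/andP[]]] //|d].
  by rewrite dirty_acting // d orbT.
have /and5P[_ _ c1 c2 _] := C.
by apply: NoMove => //; apply: D; rewrite ?rev_ordK.
Qed.

Lemma run_is_coherent t i : run_coherent t i.
Proof.
elim: t i => [|t IH] i.
  by rewrite /run_coherent /ph; case: HR => H0 _ _ _; rewrite !H0; case: first.
have own j : act R t = Some j -> run_coherent t.+1 j.
  case/own_move=> v [L E E']; have /= := coherent_step (IH j) L.
  by rewrite /run_coherent !dirty_step rev_ordK E' E.
case: (moveP (IH i)) => [E E' D D' _|v e _ _ _|v e _ _ _].
- by rewrite /run_coherent E E' D D'; apply: IH.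
- exact: own.
- have := coherent_sym (own _ e).
  by rewrite /run_coherent rev_ordK first_rev negbK.
Qed.

Lemma bakery_exclusion : mutual_exclusion R.
Proof.
move=> t i j Ci Cj; case: (ord2P i j) => // e; rewrite e in Cj.
by case: (coherent_exclusion (run_is_coherent t i)).
Qed.

Lemma bakery_first_is_write i a : invokes R i a -> first_is_write R i a.
Proof.
case=> _ Es; have /and3P[+ _ _] := run_is_coherent a i.
rewrite /wf /first_is_write /ph /= Es; case E: (loc _) => // _.
by exists (Door i), (door0 md), Probe.
Qed.

(** * Termination by rank and helper in fair runs *)

Lemma lex_wf (A : nat * nat -> Prop) :
  (forall r, (forall r', lex r' r -> A r') -> A r) -> forall r, A r.
Proof.
move=> H [p q]; elim/ltn_ind: p q => p IHp q; elim/ltn_ind: q => q IHq.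
by apply: H => -[p' q']; rewrite /lex /= => /orP[/IHp //|/andP[/eqP-> /IHq]].
Qed.

(** Induction on the rank and, inside it, on the distance to the next step of the helper, which
    exists by fairness. As long as the rank does not drop the helper stays the same, and its own
    step must lower the rank or reach [B]. *)
Lemma eventually (A B : nat -> Prop) (r : nat -> nat * nat) (h : nat -> 'I_2) :
  (forall t, A t -> sec (st R t (h t)) <> Remainder) ->
  (forall t, A t -> B t.+1 \/ A t.+1 /\ (lex (r t.+1) (r t) \/
     [/\ r t.+1 = r t, h t.+1 = h t & act R t <> Some (h t)])) ->
  forall t, A t -> exists2 u, t < u & B u.
Proof.
move=> Hact Hstep t; move e: (r t) => k.
elim/lex_wf: k t e => k IH t e At.
have [u [tu Hu _ _]] := run_next_act HR (Hact t At).
have [d Ed] : exists d, u = t + d by exists (u - t); lia.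
clear tu; elim: d t e At u Ed Hu => [|d IHd] t e At u -> Hu.
case: (Hstep t At) => [Bt|[At' [l|[_ _]]]]; first by exists t.+1.
    by rewrite e in l; have [w tw Bw] := IH _ l t.+1 erefl At'; exists w => //; lia.
  by rewrite addn0 in Hu.
case: (Hstep t At) => [Bt|[At' [l|[er eh _]]]]; first by exists t.+1.
  by rewrite e in l; have [w tw Bw] := IH _ l t.+1 erefl At'; exists w => //; lia.
rewrite -eh -addSnnS in Hu.
have [|w tw Bw] := IHd t.+1 _ At' _ erefl Hu; first by rewrite er.
by exists w => //; lia.
Qed.

Definition pick_helper (b : bool) i := if b then i else o i.

Lemma progressP i i_acts r (h : bool) r' (h' : bool) t :
  progress i_acts r h r' h' -> act R t = Some (pick_helper i_acts i) ->
  lex r' r \/ [/\ r' = r, pick_helper h' i = pick_helper h i &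
    act R t <> Some (pick_helper h i)].
Proof.
move=> /orP[|/andP[/andP[/eqP-> /eqP->] /eqP->]] ->; first by left.
right; split=> // -[]; case: i_acts; rewrite /pick_helper /=.
  by move/esym/rev_neq.
by move/rev_neq.
Qed.

Lemma competing_locking x : competing md x -> part x = Locking.
Proof. by rewrite /competing; case: (part x). Qed.

Lemma competing_wins t i : competing md (ph t i) ->
  exists2 u, t < u & winning (ph u i).
Proof.
apply: (@eventually (fun t => competing md (ph t i)) (fun t => winning (ph t i))
 (fun t => rank md (first i) (ph t i) (dirty t i) (ph t (o i)) (dirty t (o i)))
 (fun t => pick_helper
    (helper md (first i) (ph t i) (ph t (o i)) (dirty t (o i))) i))
 => {}t c; cbv beta in *.
  rewrite /pick_helper; case: ifPn => [_|nh].
    by have := competing_locking c; rewrite /= => ->.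
  by apply: (helper_active (run_is_coherent t i) nh).
case: (moveP (run_is_coherent t i)) => [E E' D D' n|v e L E E'|v e L E E'];
  cbv beta.
- by right; rewrite E E' D D' n; split=> //; right.
- have /= := rank_step (run_is_coherent t i) c L.
  rewrite -E -E' => /orP[w|/andP[c' d]]; [by left|right; split=> //].
  by rewrite rev_ordK; exact: (progressP d e).
- have /= := rank_other_step (run_is_coherent t i) c L.
  rewrite -E -E' => d; right; split; first by rewrite E'.
  by rewrite rev_ordK; exact: (progressP d e).
Qed.

Lemma winning_enters t i : winning (ph t i) -> exists2 u, t <= u & enters R i u.
Proof.
move=> w; have [|u [tu e E _]] := @run_next_act _ _ _ _ HR t i.
  by move: w; rewrite /winning /ph /=; case: (sec _).
exists u => //; have [v [+ _]] := run_advance e.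
rewrite /ph; move: w; rewrite -/(ph t i) /winning /ph /enters -E /advance /=.
case: (st R u i) => -[] // [] //= m b _; case: (st R u.+1 i) => s' p' b' [] //.
Qed.

Lemma locking_enters t i : md <> Retry \/ advanced (ph t i) ->
  sec (st R t i) = Locking -> exists2 u, t <= u & enters R i u.
Proof.
move=> H L; have [w|nw] := boolP (winning (ph t i)); first exact: winning_enters.
have [|u tu /winning_enters[w uw Ew]] := @competing_wins t i; last first.
  by exists w => //; lia.
by move: nw H; rewrite /winning /competing /advanced /= L;
   case: (loc _) => //= _; case: (md) => // -[].
Qed.

Lemma advanced_locking x : advanced x -> part x = Locking.
Proof. by rewrite /advanced; case: (part x). Qed.

Lemma approaching_advances t i :
  approaching (ph t i) -> ~~ advanced (ph t (o i)) ->
  exists2 u, t < u & advanced (ph u i) \/ advanced (ph u (o i)).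
Proof.
move=> a n.
apply: (@eventually
  (fun t => approaching (ph t i) /\ ~~ advanced (ph t (o i)))
  (fun t => advanced (ph t i) \/ advanced (ph t (o i)))
  (fun t => probe_rank (ph t i) (dirty t i) (ph t (o i)))
  (fun t => pick_helper (probe_helper (ph t i) (ph t (o i))) i)); last by [].
  move=> {a n}t [a _]; rewrite /pick_helper; case: ifPn => [_|nh].
    by move: a; rewrite /approaching /=; case: (sec _).
  exact: (probe_helper_active nh).
move=> {a n}t [a n].
case: (moveP (run_is_coherent t i)) => [E E' D D' e|v e L E E'|v e L E E'];
  cbv beta.
- by right; rewrite E E' D e; split=> //; right.
- have /= := probe_step (run_is_coherent t i) a n L.
  rewrite -E => /orP[|/andP[a' d]]; first by left; left.
  by right; split; [rewrite E' | rewrite ?dirty_step E'; exact: (progressP d e)].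
- have /= := probe_other_step md v (run_is_coherent t i) a n.
  rewrite -E => /orP[|d]; first by left; right.
  have [a'|n'] := boolP (advanced (ph t.+1 (o i))); first by left; right.
  by right; split; [rewrite E' | rewrite ?dirty_step E'; exact: (progressP d e)].
Qed.

Lemma someone_enters t i : sec (st R t i) = Locking ->
  exists2 u, t <= u & exists j, enters R j u.
Proof.
move=> L.
have adv u j : advanced (ph u j) -> exists2 w, u <= w & exists k, enters R k w.
  move=> a; have [|w uw Ew] := @locking_enters u j (or_intror a).
    exact: (advanced_locking a).
  by exists w => //; exists j.
have [/adv//|n] := boolP (advanced (ph t i)).
have [/adv//|n'] := boolP (advanced (ph t (o i))).
have a : approaching (ph t i).
  by move: n; rewrite /approaching /advanced /= L; case: (loc _).
by have [u tu [] /adv[w uw Ew]] := approaching_advances a n'; exists w => //; lia.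
Qed.

Lemma bakery_starvation_free i a : md <> Retry -> invokes R i a ->
  exists b, lock_exec R i a b.
Proof.
move=> nR ia; have [|u au Eu] := @locking_enters a.+1 i (or_introl nR).
  by rewrite (invokes_locking HR ia).
by have [b] := lock_exec_of_enters HR ia au Eu; exists b.
Qed.

(** * Counting lost competitions in runs *)

Definition run_credit i t :=
  credit (first i) (ph t i) (ph t (o i)) (dirty t (o i)).

Lemma credit_run_step i t : sec (st R t.+1 i) = Locking ->
  counted md (ph t i) ->
  [/\ counted md (ph t.+1 i), run_credit i t.+1 <= run_credit i t &
    loses R i t -> ~~ covered (ph t i) -> run_credit i t.+1 < run_credit i t].
Proof.
move=> L c; rewrite /run_credit.
have los : loses R i t -> act R t = Some (o i) /\
    part (ph t (o i)) = Locking /\ part (ph t.+1 (o i)) = Critical.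
  case=> _ [j ji Ej]; have eA := enters_act HR Ej; move: eA Ej.
  by case: (ord2P i j) ji => -> // _ [-> _] [].
case: (moveP (run_is_coherent t i)) => [E E' D D' e|v e Lg E E'|v e Lg E E'].
- by rewrite E E' D' c; split=> // /los[]; rewrite e.
- have D : dirty t.+1 (o i) =
      redirty (ph t (o i)) (dirty t (o i)) (ph t (o i)) (ph t.+1 i).
    by rewrite dirty_step rev_ordK E'.
  have := credit_step v (run_is_coherent t i) c; cbv zeta.
  rewrite -E [part (ph t.+1 i)]L D E' => /andP[le c']; split=> //.
  by case/los; rewrite e => -[/esym/rev_neq].
- have D : dirty t.+1 (o i) =
      redirty (ph t (o i)) (dirty t (o i)) (ph t.+1 (o i)) (ph t i).
    by rewrite dirty_step rev_ordK E'.
  have := credit_other_step (run_is_coherent t i) c Lg; cbv zeta.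
  rewrite -E D E' => le; split=> //.
    by apply: leq_trans le; rewrite leq_addr.
  case/los=> _ [L1 L2] nc; move: le; rewrite L1 L2 /= nc.
  by rewrite addn1.
Qed.

(** The values of the potential right after the times in [A] are pairwise distinct and less than
    [pot a]. *)
Lemma at_most_potential (pot : nat -> nat) (A : nat -> Prop) a b :
  (forall u, a <= u < b -> pot u.+1 <= pot u) ->
  (forall u, A u -> a <= u < b /\ pot u.+1 < pot u) ->
  at_most (pot a) A.
Proof.
move=> mono strict s us Hs.
have le u v : a <= u -> u <= v -> v <= b -> pot v <= pot u.
  elim: v => [|v IH] au; first by rewrite leqn0 => /eqP->.
  rewrite leq_eqVlt => /orP[/eqP-> //|uv] vb.
  by apply: leq_trans (IH au _ _); [apply: mono|..]; lia.
have inj : {in s &, injective (fun u => pot u.+1)}.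
  move=> u v /Hs/strict[Hu lu] /Hs/strict[Hv lv] e.
  case: (ltngtP u v) => // uv.
    by have := le u.+1 v; lia.
  by have := le v.+1 u; lia.
rewrite -(size_map (fun u => pot u.+1)) -[leqRHS](size_iota 0).
apply: uniq_leq_size; first by rewrite map_inj_in_uniq.
move=> _ /mapP[u /Hs/strict[Hu lu] ->]; rewrite mem_iota /=.
by have := le a u; lia.
Qed.

Lemma bypass_bound i c b : counted md (ph c i) ->
  (forall u, c <= u <= b -> sec (st R u i) = Locking) ->
  at_most (run_credit i c)
    (fun u => [/\ c <= u < b, loses R i u & ~~ covered (ph u i)]).
Proof.
move=> Cc L.
have Cu u : c <= u <= b -> counted md (ph u i).
  elim: u => [|u IH] Hu; first by move: Cc; have -> : c = 0 by lia.
  case: (ltnP u c) => uc; first by have -> : u.+1 = c by lia.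
  have Lu : sec (st R u.+1 i) = Locking by apply: L; lia.
  by case: (credit_run_step Lu (IH ltac:(lia))).
have step u : c <= u < b -> sec (st R u.+1 i) = Locking /\ counted md (ph u i).
  by move=> Hu; split; [apply: L | apply: Cu]; lia.
apply: (@at_most_potential _ _ c b) => u.
  by case/step=> Lu cu; case: (credit_run_step Lu cu).
case=> Hu lu nc; split=> //; have [Lu cu] := step u Hu.
by case: (credit_run_step Lu cu) => _ _; apply.
Qed.

Lemma ahead1 b m y dy : ahead b m y dy <= 1.
Proof. by rewrite /ahead; case: (part y); case: (behind _ _ _ _). Qed.

Lemma credit_le3 i c : run_credit i c <= 3.
Proof.
rewrite /run_credit /credit.
have p1 := past_door1 (ph c (o i)) (dirty c (o i)).
have a1 m := leq_trans (ahead1 (first i) m (ph c (o i)) (dirty c (o i))) (isT : 1 <= 3).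
by case: (at_pc (ph c i)) => *; rewrite ?a1 //; try case: ifP => _;
  rewrite ?a1 //; lia.
Qed.

(** The prefix of [Once] has no loop, so the number of completed actions determines the position in
    it. Size at most 3 means that [Raise] is not completed; this is the doorway used below, beyond
    which there is no covered write. *)
Lemma trail_size i a b u : md = Once -> lock_exec R i a b -> a < u <= b ->
  let k := size (trail R i a u) in
  match at_pc (ph u i) with
  | Enter => k = 1 | Probe => k = 2 | Raise => k = 3 | Delay _ => False
  | _ => 3 < k
  end.
Proof.
move=> eO [ia ab L _]; elim: u => [|u IH] // Hu.
have [ua|au] := leqP u a.
  have -> : u = a by lia.
  have := run_is_coherent a.+1 i => /and3P[+ _ _].
  rewrite /trail /index_iota subnn /= /wf /ph /= (invokes_locking HR ia) /=.
  have /and3P[+ _ _] := run_is_coherent a i; rewrite /wf /ph /=.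
  by case: ia => _ ->; case: (loc _).
have := IH ltac:(lia).
have -> : size (trail R i a u.+1) = size (trail R i a u) + completes R i u.
  by rewrite trail_cons // size_cat; case: (completes R i u).
move: (size _) => k {IH}.
have Lu : part (ph u i) = Locking by apply: L; lia.
have Lu1 : part (ph u.+1 i) = Locking by apply: L; lia.
case: (moveP (run_is_coherent u i)) => [E _ _ _ e|v e _ E _|v e _ _ E].
- by rewrite E /completes e /= addn0.
- rewrite /completes e eqxx -[sec _]/(part (ph u i)) Lu.
  rewrite -[busy _]/(acting (ph u.+1 i)) E in Lu1 *.
  have /and3P[+ _ _] := run_is_coherent u i.
  move: Lu Lu1; rewrite eO /advance; case: (ph u i) => s p b0 /= -> {E}.
  case: p => [||[|k']|||m|m|m|m|m|m|] /=; case: b0 => //= _ _;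
   case: v => [|v] //=; case_before; lia.
- rewrite E /completes e /=; case: eqP => [[/rev_neq//]|_] /=.
  by rewrite addn0.
Qed.

Lemma enters_win i b : enters R i b -> winning (ph b i).
Proof.
move=> Eb; have [e _] := enters_act HR Eb; case: Eb => L C.
have [v [+ _]] := run_advance e; have /and3P[+ _ _] := run_is_coherent b i.
move: L C; rewrite /ph /winning /wf /advance.
case: (st R b i) (st R b.+1 i) => s p b0 [s' p' b'] /= -> ->.
by case: p => [||[|k]|||m|m|m|m|m|m|] /=; case: b0.
Qed.

Lemma once_post_doorway i a : md = Once -> invokes R i a ->
  exists b c, [/\ lock_exec R i a b,
    completes_doorway R (fun _ l => size l <= 3) i a c, c <= b,
    (size (trail R i a c.+1)).-1 <= 3 &
    at_most 3 (fun u => c < u < b /\ loses R i u)].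
Proof.
move=> eO ia; have [|b Hb] := @bakery_starvation_free i a _ ia.
  by rewrite eO.
have [_ ab L Eb] := Hb.
have tr u := @trail_size i a b u eO Hb.
have b3 : 3 < size (trail R i a b).
  have := tr b; rewrite ab leqnn => /(_ isT); have := enters_win Eb.
  by rewrite /winning; case: part; case: at_pc.
have ex : exists u, (a < u) && (3 < size (trail R i a u.+1)).
  exists b.-1; have a1 : a.+1 < b.
    rewrite ltn_neqAle ab andbT; apply/eqP => e.
    by move: b3; rewrite -e /trail /index_iota subnn.
  by rewrite prednK ?b3 ?andbT; lia.
case: (ex_minnP ex) => c /andP[ac c3] Hmin.
have small u : a < u <= c -> size (trail R i a u) <= 3.
  move=> Hu; rewrite leqNgt; apply/negP => u3.
  have a1 : a.+1 < u.
    rewrite ltn_neqAle; apply/andP; split; last by lia.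
    by apply/eqP => e; move: u3; rewrite -e /trail /index_iota subnn.
  by have := Hmin u.-1; rewrite prednK ?u3 ?andbT; lia.
have cc : completes R i c.
  apply: contraLR c3 => /negPf nc; rewrite trail_cons // nc cats0 -leqNgt.
  by apply: small; rewrite ac leqnn.
have cb : c < b.
  by rewrite ltnNge; apply/negP => bc; have := small b; rewrite ab bc; lia.
have E4 : size (trail R i a c.+1) <= 4.
  by rewrite trail_cons // cc size_cat addn1 ltnS; apply: small; rewrite ac leqnn.
exists b, c; split; [exact: Hb| |exact: ltnW|lia|].
  by split=> //; apply/negP; rewrite -ltnNge.
have Hc : counted md (ph c.+1 i).
  have := tr c.+1 ltac:(lia); rewrite /counted [part _]L; last lia.
  by case: at_pc => //; lia.
apply: (@at_most_sub _ _ _ (fun u =>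
  [/\ c.+1 <= u < b, loses R i u & ~~ covered (ph u i)])).
  move=> u [Hu lu]; split=> //; rewrite /covered negb_and; apply/orP; right.
  have Hu' : a < u <= b by lia.
  have cu : size (trail R i a c.+1) <= size (trail R i a u).
    have [k ->] : exists k, u = c.+1 + k by exists (u - c.+1); lia.
    elim: k => [|k IH]; first by rewrite addn0.
    rewrite addnS (@trail_cons _ _ _ _ _ (c.+1 + k)); last lia.
    by rewrite size_cat (leq_trans IH) ?leq_addr.
  by have := tr u Hu'; case: at_pc => //; lia.
move=> s us Hs; apply: leq_trans (credit_le3 i c.+1).
apply: (bypass_bound Hc _ us Hs) => u Hu; apply: L; lia.
Qed.

(** For [Countdown], these starts in one process form the set of assignments: its first writes and
    its later writes that raise the door again. *)
Definition starts_covered i s := [/\ act R s = Some i,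
  sec (st R s i) = Locking, ~~ busy (st R s i) &
  at_cover (loc (st R s i))].

Lemma starts_covered_step i s : starts_covered i s ->
  st R s.+1 i = PState Locking (loc (st R s i)) true.
Proof.
case=> e L nb Hp; rewrite (pstep_start_write (run_step HR e) nb) ?L //.
rewrite /current L /=; move: Hp.
by case: (loc _) => //= _; do 3 eexists; reflexivity.
Qed.

Lemma starts_covered_ongoing i s : starts_covered i s -> ongoing R i s s.+1.
Proof.
move=> H; split=> //; first by case: H.
by move=> u Hu; have -> : u = s.+1 by [lia]; rewrite (starts_covered_step H).
Qed.

Lemma starts_covered_assignment i s : starts_covered i s -> assignment R i s.
Proof.
move=> H; exists (Door i); split; last exact: starts_covered_ongoing.
case: (H) => e L nb Hp; rewrite /writing /writes (starts_covered_step H) /current /=.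
move: Hp; case: (loc _) => //= _;
  by eexists; (split=> //); eexists; reflexivity.
Qed.

Lemma covered_ongoing i u : sec (st R u i) = Locking -> covered (ph u i) ->
  exists2 s, starts_covered i s & ongoing R i s u.
Proof.
move=> L /andP[b p]; have [s os] := busy_run_ongoing b; exists s => //.
have [su nb _] := os; have Es := ongoing_state os (_ : s < s.+1 <= u).
have {}Es : st R s.+1 i = st R u i by apply: Es; lia.
have e : act R s = Some i.
  by apply/eqP/negPn/negP => /(run_idle HR) E; rewrite -E Es [busy _]b in nb.
move: (run_step HR e) nb L p b; rewrite /starts_covered /ph /= -Es.
by case=> //= *; split.
Qed.

Definition covered_left x :=
  match at_pc x with
  | Enter => 2 - acting x
  | Probe | Delay _ => 1
  | Raise => 1 - acting x
  | _ => 0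
  end.

Lemma covered_left_step i u : sec (st R u i) = Locking ->
  sec (st R u.+1 i) = Locking ->
  covered_left (ph u.+1 i) <= covered_left (ph u i).
Proof.
move=> L L'; case: (moveP (run_is_coherent u i)) => [-> //|v _ _ E _|v _ _ _ ->//].
rewrite -[sec _]/(part (ph u.+1 i)) in L'; rewrite -[sec _]/(part (ph u i)) in L.
rewrite E in L' *; move: L L'; rewrite /advance; case: (ph u i) => s p b /= -> {E}.
by case: p => [||[|k]|||m|m|m|m|m|m|]; case: b => //=; case: (md) => //=;
  case: v => [|v] //=; case_before.
Qed.

Lemma countdown_intermittent i : md = Countdown ->
  exists A : 'I_2 -> nat -> Prop,
    (forall j s, A j s -> assignment R j s) /\
    forall a, invokes R i a ->
    exists b c,
      [/\ lock_exec R i a b, starts_first R i a c,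
          at_most 2 (fun w : 'I_2 * nat =>
            A w.1 w.2 /\ exists2 u, c < u <= b & ongoing R w.1 w.2 u) &
          at_most 3 (fun u =>
            [/\ c < u < b, loses R i u &
                ~ exists j s, A j s /\ ongoing R j s u])].
Proof.
move=> eC; exists (fun j s => j = i /\ starts_covered i s); split.
  by move=> j s [-> H]; apply: starts_covered_assignment.
move=> a ia; have [|b Hb] := @bakery_starvation_free i a _ ia.
  by rewrite eC.
have [_ ab L Eb] := Hb; have [c [Hc Ec _]] := starts_first_ex HR ia.
have [ac actc _] := Hc; rewrite (invokes_locking HR ia) in Ec.
have Hl : loc (st R a i) = Enter.
  by have /and3P[+ _ _] := run_is_coherent a i; rewrite /wf /ph /=;
     case: ia => _ ->; case: (loc _).
rewrite Hl in Ec.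
have sc : starts_covered i c by rewrite /starts_covered Ec.
have Ec1 := starts_covered_step sc; rewrite Ec /= in Ec1.
have cb : c < b.
  rewrite ltnNge; apply/negP => bc.
  have [nb _ nE] := And3 (proj1 (proj2 (enters_act HR Eb))) I (enters_win Eb).
  have e : st R b i = st R a.+1 i.
    apply: (run_idle_until HR); first by [].
    by move=> v Hv; apply/eqP; case: Hc => _ _; apply; lia.
  by move: nE; rewrite /ph e (invokes_locking HR ia) /winning /= Hl.
exists b, c; split=> //.
  (* All members of the set belong to [i], those meeting the period start at [c] or later, and each
     start lowers [covered_left], which is 2 at [c]. *)
  move=> s us Hs; rewrite -(size_map snd).
  have K w : w \in s -> w.1 = i /\ c <= w.2 < b /\ starts_covered i w.2.
    case: w => j w /Hs /= [[-> Hw] [u Hu ou]]; split=> //; split=> //.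
    have [wu nb H] := ou; have wb : w < b by lia.
    rewrite wb andbT leqNgt; apply/negP => wc.
    by have := H c ltac:(lia); rewrite Ec.
  have : at_most (covered_left (ph c i)) (fun u => c <= u < b /\ starts_covered i u).
    apply: (@at_most_potential (fun u => covered_left (ph u i)) _ c b) => u.
      by move=> Hu; apply: covered_left_step; apply: L; lia.
    case=> Hu Hsc; split=> //; rewrite /ph (starts_covered_step Hsc).
    case: Hsc => _ _ + ; rewrite /covered_left /=.
    by case: (loc _) => //=; case: (busy _).
  rewrite /ph Ec => H; apply: H.
    rewrite map_inj_in_uniq // => -[j w] [j' w'] /K[/= -> _] /K[/= -> _] -> //.
  by move=> _ /mapP[w /K[_ Kw] ->].
apply: (@at_most_sub _ _ _ (fun u =>
  [/\ c.+1 <= u < b, loses R i u & ~~ covered (ph u i)])).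
  move=> u [Hu lu nA]; split=> //; apply/negP => cu; apply: nA.
  have [|s Hs os] := @covered_ongoing i u _ cu; first by apply: L; lia.
  by exists i, s.
move=> s us Hs; apply: leq_trans (credit_le3 i c.+1).
apply: (bypass_bound _ _ us Hs); first by rewrite /ph Ec1 eC.
by move=> u Hu; apply: L; lia.
Qed.

End BakeryRuns.

(** * Simulated runs *)

Lemma wf_advance md b x v : wf x -> wf (advance md b x v).
Proof.
by case: x => [[] [||[|k]|||m|m|m|m|m|m|] []] //=; rewrite /advance /wf /=;
  case: (md) => //; case: v => [|v] //=; case_before.
Qed.

Lemma pstep_advance md i (ret : forall r : reg (bakery md), dom r -> Prop)
    (x y : pstate (bakery md)) v :
  wf (phase_of x) ->
  (forall r, (if r is Door _ then at_door_read else at_number_read) (loc x) ->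
     busy x -> owner r = rev_ord i -> ret r v) ->
  phase_of y = advance md (first i) (phase_of x) v -> pstep i ret x y.
Proof.
case: x y => s p b [s' p' b'] /= w H; rewrite /phase_of /advance /= ord_of_first.
move: w H; case: s => /=; case: p => [||[|k]|||m|m|m|m|m|m|];
  case: b => //= _ H [-> -> ->];
  try (by [exact: Invoke | exact: Leave]);
  try first [ by eapply StartRead; reflexivity
        | by eapply StartWrite; reflexivity
        | by eapply EndWrite; reflexivity
        | by eapply LocalStep; reflexivity
        | by eapply ReturnLock; reflexivity
        | by eapply ReturnUnlock; reflexivity].
- exact (@EndRead 2 (bakery md) i ret Locking Probe (Number (rev_ord i)) _ v
    erefl (H (Number _) isT isT erefl)).
- exact (@EndRead 2 (bakery md) i ret Locking Draw (Number (rev_ord i)) _ v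
    erefl (H (Number _) isT isT erefl)).
- exact (@EndRead 2 (bakery md) i ret Locking (AwaitDoor _) (Door (rev_ord i)) _ v
    erefl (H (Door _) isT isT erefl)).
- exact (@EndRead 2 (bakery md) i ret Locking (AwaitTurn _) (Number (rev_ord i)) _ v
    erefl (H (Number _) isT isT erefl)).
Qed.

Section Simulation.

Variables (md : variant) (sch : nat -> bool * nat).

(* The hint [v] is the result of a read only if it is legal, that is, if the
   read overlaps a write. *)
Definition read_value x y (v : nat) :=
  if clash x y then v else
  if at_door_read (at_pc x) then door md (at_pc y) else ticket (at_pc y).

Definition sim (c : phase * phase) (a : bool * nat) : phase * phase :=
  if a.1 then (advance md true c.1 (read_value c.1 c.2 a.2), c.2)
  else (c.1, advance md false c.2 (read_value c.2 c.1 a.2)).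

Definition start : phase * phase :=
  (Phase Remainder Enter false, Phase Remainder Enter false).

Fixpoint conf t := if t is t'.+1 then sim (conf t') (sch t') else start.

Definition proc (c : phase * phase) (i : 'I_2) := if first i then c.1 else c.2.

Definition pstate_of (x : phase) : pstate (bakery md) :=
  @PState 2 (bakery md) (part x) (at_pc x) (acting x).

(** While a write is going on, [content] keeps the old value, which safe registers permit. *)
Definition simulation : history (bakery md) := @History 2 (bakery md)
  (fun t => Some (if (sch t).1 then ord0 else ord_max))
  (fun t i => pstate_of (proc (conf t) i))
  (fun t r => value md r (at_pc (proc (conf t) (owner r))))
  (fun _ => None).

Lemma phase_of_sim t i : phase_of (st simulation t i) = proc (conf t) i.
Proof. by rewrite /phase_of /=; case: (proc _ _). Qed.

Lemma sim_step t i : act simulation t = Some i -> exists v,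
  [/\ proc (conf t.+1) i = advance md (first i) (proc (conf t) i) v,
      forall j, j <> i -> proc (conf t.+1) j = proc (conf t) j &
      v = read_value (proc (conf t) i) (proc (conf t) (rev_ord i)) (sch t).2].
Proof.
move=> [<-]; eexists; split; last reflexivity.
  by rewrite /proc /= /sim; case: (sch t) => [[]].
move=> j; rewrite /proc /= /sim; case: (sch t) => [[] v] /=;
  by case: j => -[|[|]] // ? /(_ (val_inj _)) H; case: H.
Qed.

Lemma wf_conf t i : wf (proc (conf t) i).
Proof.
elim: t i => [|t IH] i; first by rewrite /proc; case: first.
have [v [E E' _]] := @sim_step t _ erefl.
case: (eqVneq i (if (sch t).1 then ord0 else ord_max)) => [->|/eqP/E' -> //].
by rewrite E wf_advance.
Qed.

Lemma sim_writing t i r : acting (proc (conf t) i) -> owner r = i ->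
  at_write r (at_pc (proc (conf t) i)) -> writing simulation t i r.
Proof.
move=> b Er w; have := wf_conf t i; have [v [q E]] : exists v q,
    code md i (at_pc (proc (conf t) i)) = Write r v q.
  by move: w; rewrite -Er; case: (r) => j /=;
     case: (at_pc _) => //= *; do 2 eexists; reflexivity.
rewrite /wf => Hw; exists v; split; first exact: b.
exists q; rewrite /current /= E; move: b w Hw {E}.
by case: (proc (conf t) i) => -[] p [] //= _; case: (r); case: p.
Qed.

Hypothesis fair : forall t b, exists2 u, t <= u & (sch u).1 = b.

Lemma simulation_run : run simulation Safe.
Proof.
split.
- by move=> i; rewrite /= /proc; case: first.
- move=> t; case e: (act simulation t) => [i|] //.
  have [v [E E' Ev]] := sim_step e; split; last first.
    by move=> j /E' {}E' ; rewrite /= -/(conf t.+1) E'.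
  apply: (@pstep_advance md i _ _ _ v); rewrite ?phase_of_sim ?wf_conf //.
  move=> r Hr b Er.
  (* A read during which nothing is written does not clash when it terminates, so [read_value]
     ignores the hint and yields the content. *)
  have [|s os] := @busy_ongoing _ _ simulation i t _ b.
    by rewrite /= /proc; case: first.
  exists s => // nw.
  have nc : ~~ clash (proc (conf t) i) (proc (conf t) (rev_ord i)).
    apply/negP => c; apply: (nw t (rev_ord i)); first by case: os; lia.
    move: c => /and3P[_ bj c]; apply: sim_writing => //.
    move: Hr c; rewrite -[loc _]/(at_pc (proc (conf t) i)).
    by case: (r) => j; case: (at_pc (proc (conf t) i)) => //= *;
      match goal with H : is_true (_ || _) |- _ => rewrite orbF in H end.
  rewrite Ev /read_value (negPf nc) /= Er.
  by case: r Hr {nw Er} => j /=; case: (at_pc _).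
- split; first by move=> r; rewrite /= /proc; case: first; case: r.
  split=> [t r nw|s t i r v os e Hw _].
    have [v [E E' _]] := @sim_step t _ erefl.
    case: (eqVneq (owner r) (if (sch t).1 then ord0 else ord_max)) => [Er|/eqP/E' E2].
      rewrite /= -/(conf t.+1) Er E value_advance //.
      by apply/negP => /andP[b w]; exact: (nw _ (sim_writing b Er w)).
    by rewrite /= -/(conf t.+1) E2.
  have [Er b w [q Eq]] := writesE Hw.
  have [v' [E E' _]] := sim_step e.
  rewrite /ph phase_of_sim in b w; rewrite /= -/(conf t.+1) -Er E.
  have := wf_conf t i; move: b Eq; rewrite /advance /wf /= ord_of_first.
  case: (proc _ i) => s' p b' /= -> Eq Hp.
  have : if code md i p is Write r v q then value md r q = v else True.
    by case: (p).
  rewrite Eq; case: s' Hp => /=; by [rewrite Eq | case: (p)].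
- move=> t i _; have [u tu Hu] := fair t (first i); exists u => //=.
  by rewrite Hu ord_of_first.
Qed.
End Simulation.

(** * Periodic schedules *)

Section Schedules.

Variables (md : variant) (pre rnd : seq (bool * nat)) (go : nat -> bool).

(* [pre], then rounds [rnd] as long as [go] says so, then both processes in
   turn; [true] stands for process 0 and the number is the read hint. *)
Definition schedule t :=
  if t < size pre then nth (true, 0) pre t else
  if go ((t - size pre) %/ size rnd)
  then nth (true, 0) rnd ((t - size pre) %% size rnd) else (odd t, 0).

Notation cf := (conf md schedule).
Definition turn_point := foldl (sim md) start pre.

Lemma conf_add t m :
  cf (t + m) = foldl (sim md) (cf t) (mkseq (fun j => schedule (t + j)) m).
Proof.
elim: m => [|m IH]; first by rewrite addn0.
by rewrite addnS mkseqS foldl_rcons -IH.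
Qed.

Lemma mkseq_take (T : Type) (x0 : T) (s : seq T) f m : m <= size s ->
  (forall j, j < m -> f j = nth x0 s j) -> mkseq f m = take m s.
Proof.
move=> ms H; apply: (@eq_from_nth _ x0); rewrite size_mkseq ?size_takel //.
by move=> j jm; rewrite nth_mkseq // nth_take // H.
Qed.

Lemma conf_prefix t : t <= size pre -> cf t = foldl (sim md) start (take t pre).
Proof.
move=> tp; rewrite -[t]add0n conf_add; congr foldl.
apply: (@mkseq_take _ (true, 0)) => // j jt.
by rewrite /schedule add0n; case: ltnP => //; lia.
Qed.

Lemma conf_turn_point : cf (size pre) = turn_point.
Proof. by rewrite conf_prefix // take_size. Qed.

Hypothesis rnd_loop : foldl (sim md) turn_point rnd = turn_point.

Lemma conf_round k r : (forall k', k' <= k -> go k') -> r <= size rnd ->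
  cf (size pre + k * size rnd + r) = foldl (sim md) turn_point (take r rnd).
Proof.
elim: k r => [|k IH] r H rr; rewrite conf_add.
  rewrite mul0n addn0 conf_turn_point; congr foldl.
  apply: (@mkseq_take _ (true, 0)) => // j jr; rewrite /schedule ltnNge leq_addr /=.
  by rewrite addKn divn_small ?modn_small ?H //; lia.
have -> : size pre + k.+1 * size rnd = size pre + k * size rnd + size rnd by lia.
rewrite IH // => [|k' kk]; last by apply: H; lia.
rewrite take_size rnd_loop; congr foldl.
apply: (@mkseq_take _ (true, 0)) => // j jr.
rewrite /schedule ltnNge -!addnA leq_addr /=.
rewrite addKn addnA -mulSnr divnMDl ?divn_small ?modnMDl ?modn_small ?addn0 ?H //; lia.
Qed.

End Schedules.

Lemma fair_rounds pre rnd t b : 0 < size rnd ->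
  (forall b', exists2 j, j < size rnd & (nth (true, 0) rnd j).1 = b') ->
  exists2 u, t <= u & (schedule pre rnd xpredT u).1 = b.
Proof.
move=> r0 /(_ b)[j jr <-]; exists (size pre + t * size rnd + j); first nia.
rewrite /schedule ltnNge -addnA leq_addr /= addKn.
by rewrite modnMDl modn_small.
Qed.

Lemma fair_finite pre rnd N t b : 0 < size rnd ->
  exists2 u, t <= u & (schedule pre rnd (fun k => k < N) u).1 = b.
Proof.
(* After all rounds the parity of the time selects the process, and twice a number plus [b] has
   parity [b]. *)
move=> r0; exists ((t + size pre + N * size rnd).*2 + b); first lia.
rewrite /schedule; case: ltnP => [|_]; first lia.
case: ltnP => [|_] /=; last by rewrite oddD odd_double oddb.
rewrite ltn_divLR //; lia.
Qed.

(** * Concrete schedules and repeated overtaking *)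

Notation solo k := (nseq k (true, 0)).
Notation other k := (nseq k (false, 0)).

(** Process 1 completes its first write. In each round process 0 enters with its 18th step, process
    1 makes a full read while the other ticket is held, and 4 more steps bring process 0 back to its
    remainder section. *)
Definition retry_pre : seq (bool * nat) := other 3.
Definition retry_rnd : seq (bool * nat) := solo 18 ++ other 2 ++ solo 4.
Definition retry_run := simulation Retry (schedule retry_pre retry_rnd xpredT).

Lemma retry_starves : run retry_run Safe /\ invokes retry_run ord_max 0 /\
  forall b, ~ lock_exec retry_run ord_max 0 b.
Proof.
have HR : run retry_run Safe.
  apply: simulation_run => t b; apply: fair_rounds => // -[].
    by exists 0.
  by exists 18.
do 2 split=> //; move=> b [_ b0 _ /(enters_win HR)].
rewrite /ph phase_of_sim /proc /=.
have [b3|b3] := ltnP b 3.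
  rewrite conf_prefix; last by apply: ltnW.
  by case: b b3 {b0} => [|[|[|]]].
have loop : foldl (sim Retry) (turn_point Retry retry_pre) retry_rnd =
    turn_point Retry retry_pre by vm_compute.
have -> : b = size retry_pre + (b - 3) %/ 24 * size retry_rnd + (b - 3) %% 24.
  by rewrite -addnA -[size retry_rnd]/24 -divn_eq subnKC.
rewrite (conf_round loop); [|by []|by apply: ltnW; rewrite ltn_mod].
have : (b - 3) %% 24 < 24 by rewrite ltn_mod.
move: (_ %% 24) => r; have : all (fun r => ~~ winning
  (foldl (sim Retry) (turn_point Retry retry_pre) (take r retry_rnd)).2) (iota 0 24).
  by vm_compute.
by move=> /allP/(_ r); rewrite mem_iota => H /H /negPf ->.
Qed.

Lemma overtaking_run md pre rnd N : 0 < size rnd ->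
  run (simulation md (schedule pre rnd (fun k => k < N))) Safe.
Proof. by move=> r0; apply: simulation_run => t b; apply: fair_finite. Qed.

Definition overtaking (pre rnd : seq (bool * nat)) e k :=
  size pre + k * size rnd + e.

Lemma overtaking_lt pre rnd N e k : e < size rnd -> k < N ->
  overtaking pre rnd e k < size pre + N * size rnd.
Proof. by rewrite /overtaking; nia. Qed.

Lemma overtaking_unbounded pre rnd N e k (A : nat -> Prop) : e < size rnd ->
  (forall m, m < N -> A (overtaking pre rnd e m)) -> at_most k A -> N <= k.
Proof.
move=> er H /(_ (mkseq (overtaking pre rnd e) N)); rewrite size_mkseq; apply.
  rewrite mkseq_uniq // => m m' /eqP; rewrite /overtaking eqn_add2r eqn_add2l.
  by rewrite eqn_pmul2r => [/eqP//|]; lia.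
by move=> _ /mapP[m + ->]; rewrite mem_iota => mN; apply: H.
Qed.

(** * Process 0 overtakes a process 1 that makes no step *)

Section Overtaking.

Variables (md : variant) (pre rnd : seq (bool * nat)) (N e a : nat).
Notation sch := (schedule pre rnd (fun k => k < N)).
Notation R := (simulation md sch).
Notation tp := (turn_point md pre).

Hypothesis rnd_solo : all fst rnd.
Hypothesis e_rnd : e < size rnd.

Lemma foldl_solo c s : all fst s -> (foldl (sim md) c s).2 = c.2.
Proof. by elim: s c => //= -[[] v] s IH c //= /IH ->. Qed.

Lemma overtaken t : size pre <= t <= size pre + N * size rnd ->
  (conf md sch t).2 = tp.2.
Proof.
move=> Ht; have -> : t = size pre + (t - size pre) by lia.
rewrite conf_add conf_turn_point foldl_solo //.
apply/(all_nthP (true, 0)); rewrite size_mkseq => j jt; rewrite nth_mkseq //.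
rewrite /schedule ltnNge leq_addr /= addKn ltn_divLR; last lia.
case: ltnP => [_|]; last lia.
by apply: (all_nthP (true, 0) rnd_solo); rewrite ltn_mod; lia.
Qed.

Hypothesis rnd_loop : foldl (sim md) tp rnd = tp.
Hypothesis e_lock : part (foldl (sim md) tp (take e rnd)).1 = Locking.
Hypothesis e_enter : part (foldl (sim md) tp (take e.+1 rnd)).1 = Critical.
Hypothesis tp_lock : part tp.2 = Locking.

Lemma overtaking_loses k : k < N ->
  loses R ord_max (overtaking pre rnd e k) /\ enters R ord0 (overtaking pre rnd e k).
Proof.
move=> kN; have lt := overtaking_lt pre e_rnd kN.
have E r : r <= size rnd -> conf md sch (size pre + k * size rnd + r) =
    foldl (sim md) tp (take r rnd).
  by move=> rr; apply: conf_round => // k' kk; lia.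
have L : enters R ord0 (overtaking pre rnd e k).
  split; rewrite /= /proc /=; first by rewrite E // ltnW.
  rewrite -[sim _ _ _]/(conf md sch (overtaking pre rnd e k).+1).
  by rewrite /overtaking -addnS E.
split=> //; split; last by exists ord0.
rewrite /= /proc /= overtaken //.
by apply/andP; split; [rewrite /overtaking -addnA leq_addr | apply: ltnW].
Qed.

Hypothesis tp_win : ~~ winning tp.2.
Hypothesis pre_win : forall t, a < t <= size pre ->
  ~~ winning (foldl (sim md) start (take t pre)).2.

Lemma overtaken_end b : lock_exec R ord_max a b -> size pre + N * size rnd < b.
Proof.
have r0 : 0 < size rnd by lia.
case=> _ ab _ /(enters_win (overtaking_run md pre N r0)).
rewrite /ph phase_of_sim /proc /= => w; rewrite ltnNge; apply/negP => bN.
have [pb|bp] := leqP (size pre) b.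
  by rewrite overtaken ?pb // (negPf tp_win) in w.
have := @pre_win b; rewrite -(@conf_prefix md pre rnd (fun k => k < N)) ?w; lia.
Qed.

End Overtaking.

(** * The three separations *)

Definition protocol_of md := @ForSize 2 isT (bakery md).

Lemma bakery_mutex md : mutex_protocol Safe (protocol_of md).
Proof. by move=> R HR; split=> //; apply: bakery_exclusion. Qed.

Lemma bakery_starts_with_write md : lock_starts_with_write Safe (protocol_of md).
Proof. by move=> R HR i a; apply: bakery_first_is_write. Qed.

Lemma separated_deadlock_starvation : separated DeadlockFreedom StarvationFreedom.
Proof.
exists Safe, (protocol_of Retry); split; [exact: bakery_mutex |
  exact: bakery_starts_with_write | |].
  by move=> R HR t i; apply: someone_enters.
have [HR [ia Hb]] := retry_starves.
by move/(_ _ HR _ _ ia) => [b /Hb].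
Qed.

Section OnceRun.

Variable N : nat.
(** The 4 initial steps take process 1 into the read of [Probe]. A lap of process 0 has 22 steps,
    and the one with offset 17 is its entry. *)
Notation rnd := (solo 22).
Notation R := (simulation Once (schedule (other 4) rnd (fun k => k < N))).

Lemma once_run : run R Safe.
Proof. by apply: overtaking_run. Qed.

Lemma once_prefix t : 0 < t <= 4 ->
  ~~ winning (foldl (sim Once) start (take t (other 4))).2.
Proof. by case: t => [|[|[|[|[|]]]]]. Qed.

Lemma once_start : starts_first R ord_max 0 1.
Proof. by split=> // u; lia. Qed.

(** No assignment excuses these losses: whenever process 0 enters it is not busy, and process 1 is
    in the middle of a read. *)
Lemma once_unbounded f h A : (forall j s, A j s -> assignment R j s) ->
  (exists b c, [/\ lock_exec R ord_max 0 b, starts_first R ord_max 0 c,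
      at_most h (fun w : 'I_2 * nat =>
        A w.1 w.2 /\ exists2 u, c < u <= b & ongoing R w.1 w.2 u) &
      at_most f (fun u => [/\ c < u < b, loses R ord_max u &
        ~ exists j s, A j s /\ ongoing R j s u])]) -> N <= f.
Proof.
move=> HA [b [c [Hb Hc _ Hf]]].
have ec := starts_first_uniq Hc once_start; subst c.
have loop : foldl (sim Once) (turn_point Once (other 4)) rnd =
  turn_point Once (other 4) by vm_compute.
have bN : 4 + N * 22 < b.
  exact: (@overtaken_end Once (other 4) rnd N 0 0 isT isT isT once_prefix b Hb).
apply: (@overtaking_unbounded (other 4) rnd N 17 f _ isT _ Hf) => m mN.
have [lo en] : loses R ord_max (overtaking (other 4) rnd 17 m) /\
    enters R ord0 (overtaking (other 4) rnd 17 m).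
  by apply: (@overtaking_loses Once (other 4) rnd N 17 isT isT loop _ _ _ m mN);
    vm_compute.
have mb := @overtaking_lt (other 4) rnd N 17 m isT mN.
split; first apply/andP; first split; [|exact: ltn_trans mb bN|exact: lo|].
  by rewrite /overtaking -addnA leq_addr.
case=> j [s [/HA[r [w _]] os]].
have [su _ bu] := os.
case: (ord2P ord0 j) => ej; subst j.
  have [_ [/negP + _]] := enters_act once_run en; apply; apply: bu.
  by rewrite su leqnn.
have ej : rev_ord ord0 = ord_max :> 'I_2 by apply: val_inj.
rewrite ej in w os; have [_ _] := writingE w.
rewrite /ph (ongoing_state once_run os); last by rewrite ltnSn.
rewrite phase_of_sim /proc -[first _]/false.
rewrite (@overtaken Once (other 4) rnd N 0 isT isT).
  by case: (r).
by apply/andP; split; [rewrite /overtaking -addnA leq_addr | exact: ltnW].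
Qed.

End OnceRun.

Lemma separated_doorway_intermittent :
  separated PostDoorwayBoundedBypass IntermittentBoundedBypass.
Proof.
exists Safe, (protocol_of Once); split; [exact: bakery_mutex |
  exact: bakery_starts_with_write | |].
  exists (fun=> 3), (fun=> 3); exists (fun _ l => size l <= 3).
  by move=> R HR i a; apply: once_post_doorway.
case=> f [h /= H]; have [A [HA Ha]] := H _ (once_run (f 2).+1) ord_max.
have := @once_unbounded (f 2).+1 (f 2) (h 2) A HA (Ha 0 (conj erefl erefl)).
by rewrite ltnn.
Qed.

Lemma sim_completes md sch t : (sch t).1 = false ->
  part (conf md sch t).2 = Locking -> acting (conf md sch t.+1).2 = false ->
  completes (simulation md sch) ord_max t.
Proof. by move=> S L A; rewrite /completes /= S L /= -/(conf md sch t.+1) A. Qed.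

Section CountdownRun.

Variables N d : nat.
(** A lap has one step more than in [Once], namely the one at [Delay 0], so the entry has offset
    18. *)
Notation rnd := (solo 23).
(* Process 0 stops while writing its ticket, so that process 1 can read any
   value, here [d.+1]. *)
Definition head_part : seq (bool * nat) := solo 11 ++ other 4 ++ [:: (false, d.+1)].
Arguments head_part : simpl never.
(** Process 1 starts its second door write; process 0 then completes its lap, reading that door as 0
    during the write. *)
Definition tail_part : seq (bool * nat) := other 1 ++ solo 12.
Notation pre := (head_part ++ other d.+2 ++ tail_part).
Notation R := (simulation Countdown (schedule pre rnd (fun k => k < N))).
Notation run_from := (foldl (sim Countdown)).

Lemma size_pre : size pre = d + 31.
Proof. by rewrite !size_cat !size_nseq /=; lia. Qed.

Definition counting k : phase * phase :=
  (Phase Locking (Post 0) true, Phase Locking (Delay k) false).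
Definition counted_down : phase * phase :=
  (Phase Locking (Post 0) true, Phase Locking Raise false).

Lemma run_head : run_from start head_part = counting d.+1.
Proof. by []. Qed.

Lemma run_count j k : run_from (counting (j + k)) (other j) = counting k.
Proof. by elim: j => [|j IH] //=; rewrite -[RHS]IH. Qed.

Lemma run_counted : run_from (counting d.+1) (other d.+2) = counted_down.
Proof.
by rewrite -[d.+2]addn1 nseqD foldl_cat -[in counting _](addn0 d.+1) run_count.
Qed.

Lemma countdown_turn_point : turn_point Countdown pre =
  (Phase Remainder Enter false, Phase Locking Raise true).
Proof. by rewrite /turn_point foldl_cat run_head foldl_cat run_counted. Qed.

Lemma countdown_run : run R Safe.
Proof. by apply: overtaking_run. Qed.

Lemma take_head j s : take (16 + j) (head_part ++ s) = head_part ++ take j s.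
Proof. by []. Qed.

Lemma nth_head j s :
  nth (true, 0) (head_part ++ s) (16 + j) = nth (true, 0) s j.
Proof. by []. Qed.

Lemma take_count m k s : take (m + k) (other m ++ s) = other m ++ take k s.
Proof. by rewrite take_cat size_nseq ltnNge leq_addr addKn. Qed.

Lemma conf_counting j : j <= d.+1 ->
  conf Countdown (schedule pre rnd (fun k => k < N)) (16 + j) = counting (d.+1 - j).
Proof.
move=> jd; rewrite conf_prefix; last by rewrite size_pre; lia.
rewrite take_head takel_cat ?size_nseq ?take_nseq; [|lia..].
by rewrite foldl_cat run_head -{1}(subnKC jd) run_count.
Qed.

Lemma countdown_prefix t : 11 < t <= size pre ->
  ~~ winning (run_from start (take t pre)).2.
Proof.
move=> Ht; have [t16|t16] := ltnP t 16.
  rewrite takel_cat //; last by apply: ltnW.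
  by move: Ht t16; do 16 (case: t => [|t] //).
have [td|td] := leqP t (16 + d.+1).
  rewrite -(@conf_prefix Countdown pre rnd (fun k => k < N)); last by case/andP: Ht.
  by rewrite -(subnKC t16) conf_counting //; lia.
rewrite size_pre in Ht.
have [k [k13 ->]] : exists k, k <= 13 /\ t = 16 + (d.+2 + k).
  by exists (t - 18 - d); lia.
rewrite take_head take_count.
rewrite foldl_cat run_head foldl_cat run_counted.
by move: k13; do 14 (case: k => [|k] //).
Qed.

Lemma countdown_invokes : invokes R ord_max 11.
Proof. by split=> //; rewrite /= /proc /=. Qed.

(** The [d.+1] local steps at times 16 to 16 + [d] are completed actions, so any doorway of at most
    [d] actions ends while process 1 is still counting, before the rounds of overtaking. *)
Lemma countdown_trail c : (size (trail R ord_max 11 c.+1)).-1 <= d -> c < 17 + d.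
Proof.
move=> H; rewrite ltnNge; apply/negP => dc; move: H; apply/negP; rewrite -ltnNge.
rewrite /= size_map -[leqLHS](size_iota 16).
apply: uniq_leq_size; first exact: iota_uniq.
move=> u; rewrite mem_iota => Hu.
rewrite mem_filter mem_index_iota; apply/andP; split; last by lia.
have [j ej] : exists j, u = 16 + j by exists (u - 16); lia.
have jd : j <= d by lia.
pose sch := schedule pre rnd (fun k => k < N).
have S : sch (16 + j) = (false, 0).
  rewrite /sch /schedule size_pre; have -> : 16 + j < d + 31 by lia.
  by rewrite nth_head nth_cat size_nseq nth_nseq; have -> : j < d.+2 by lia.
have c0 : (conf Countdown sch (16 + j)).2 = Phase Locking (Delay (d.+1 - j)) false.
  by rewrite conf_counting //; lia.
have c1 : (conf Countdown sch (16 + j).+1).2 = Phase Locking (Delay (d - j)) false.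
  by rewrite -addnS conf_counting.
rewrite ej; exact: (@sim_completes Countdown sch _
  (congr1 fst S) (congr1 part c0) (congr1 acting c1)).
Qed.

Lemma countdown_unbounded f D : (exists b c, [/\ lock_exec R ord_max 11 b,
    completes_doorway R D ord_max 11 c, c <= b,
    (size (trail R ord_max 11 c.+1)).-1 <= d &
    at_most f (fun u => c < u < b /\ loses R ord_max u)]) -> N <= f.
Proof.
case=> b [c [Hb _ _ /countdown_trail cd Hf]].
have tp := countdown_turn_point.
have loop : foldl (sim Countdown) (turn_point Countdown pre) rnd =
  turn_point Countdown pre by rewrite tp.
have bN : size pre + N * 23 < b.
  apply: (@overtaken_end Countdown pre rnd N 0 11 isT isT _ countdown_prefix b Hb).
  by rewrite tp.
apply: (@overtaking_unbounded pre rnd N 18 f _ isT _ Hf) => m mN.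
have [lo _] : loses R ord_max (overtaking pre rnd 18 m) /\
    enters R ord0 (overtaking pre rnd 18 m).
  by apply: (@overtaking_loses Countdown pre rnd N 18 isT isT loop _ _ _ m mN);
    rewrite tp.
have mb := @overtaking_lt pre rnd N 18 m isT mN.
split; last exact: lo.
apply/andP; split; last exact: ltn_trans mb bN.
by rewrite /overtaking size_pre; lia.
Qed.

End CountdownRun.

Lemma separated_intermittent_doorway :
  separated IntermittentBoundedBypass PostDoorwayBoundedBypass.
Proof.
exists Safe, (protocol_of Countdown); split; [exact: bakery_mutex |
  exact: bakery_starts_with_write | |].
  by exists (fun=> 3), (fun=> 2) => R HR i; apply: countdown_intermittent.
case=> f [d [D H]]; have := H _ (countdown_run (f 2).+1 (d 2)) ord_max 11.
move=> /(_ (countdown_invokes _ _))/countdown_unbounded; by rewrite ltnn.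
Qed.

(** * All implications and separations from the basic ones *)

Lemma separated_mono p p' q q' : entails p p' -> entails q' q ->
  separated p q -> separated p' q'.
Proof.
move=> pp qq [M [P [Hm Hw Hp Hq]]]; exists M, P; split=> //; first exact: pp.
by move/(qq M P Hm).
Qed.

Lemma entails_refl p : entails p p.
Proof. by []. Qed.

Lemma entails_trans p q r : entails p q -> entails q r -> entails p r.
Proof. by move=> pq qr M P H /(pq M P H)/(qr M P H). Qed.

Lemma entails_obtained p q : obtained p q -> entails p q.
Proof.
elim=> [{}p {}q []|{}p r {}q _ pr _ rq]; last exact: entails_trans pr rq.
- exact: bounded_post_doorway.
- exact: bounded_intermittent.
- exact: post_doorway_starvation.
- exact: intermittent_starvation.
- exact: starvation_deadlock.
Qed.

Definition same_or_obtained p q := p = q \/ obtained p q.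

Lemma same_or_obtained_entails p q : same_or_obtained p q -> entails p q.
Proof. by case=> [->|/entails_obtained]. Qed.

(** A Boolean table of the reflexive transitive closure of [basic]. *)
Definition reaches p q :=
  match p, q with
  | BoundedBypass, _ | _, DeadlockFreedom
  | StarvationFreedom, StarvationFreedom
  | PostDoorwayBoundedBypass, (PostDoorwayBoundedBypass | StarvationFreedom)
  | IntermittentBoundedBypass, (IntermittentBoundedBypass | StarvationFreedom)
     => true
  | _, _ => false
  end.

Lemma reaches_obtained p q : reaches p q -> same_or_obtained p q.
Proof.
have s5 := t_step _ _ _ _ basic5; have s4 := t_step _ _ _ _ basic4.
have s3 := t_step _ _ _ _ basic3; have s2 := t_step _ _ _ _ basic2.
have s1 := t_step _ _ _ _ basic1.
have s13 := t_trans _ _ _ _ _ s1 s3; have s35 := t_trans _ _ _ _ _ s3 s5.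
have s45 := t_trans _ _ _ _ _ s4 s5; have s135 := t_trans _ _ _ _ _ s1 s35.
by case: p; case: q => //; first [by left | by right].
Qed.

(** Every pair outside the table [reaches] arises from one of the three separations by weakening the
    property that holds and strengthening the one that fails. *)
Lemma separated_not_obtained p q : p <> q -> ~ obtained p q -> separated p q.
Proof.
have e p' q' : reaches p' q' -> entails p' q'.
  by move/reaches_obtained/same_or_obtained_entails.
have W1 p' q' : reaches DeadlockFreedom p' -> reaches q' StarvationFreedom ->
    separated p' q'.
  by move=> /e H /e H'; apply: separated_mono H H' separated_deadlock_starvation.
have W2 p' q' : reaches PostDoorwayBoundedBypass p' ->
    reaches q' IntermittentBoundedBypass -> separated p' q'.
  by move=> /e H /e H'; apply: separated_mono H H' separated_doorway_intermittent.
have W3 p' q' : reaches IntermittentBoundedBypass p' ->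
    reaches q' PostDoorwayBoundedBypass -> separated p' q'.
  by move=> /e H /e H'; apply: separated_mono H H' separated_intermittent_doorway.
move=> pq npq; have : ~~ reaches p q by apply/negP => /reaches_obtained[].
case: p {pq npq}; case: q => // _;
  by [apply: W1 | apply: W2 | apply: W3].
Qed.

Theorem theorem3p8 :
  (entails BoundedBypass PostDoorwayBoundedBypass /\
   entails BoundedBypass IntermittentBoundedBypass /\
   entails PostDoorwayBoundedBypass StarvationFreedom /\
   entails IntermittentBoundedBypass StarvationFreedom /\
   entails StarvationFreedom DeadlockFreedom) /\
  (forall p q : property, p <> q -> ~ obtained p q -> separated p q) /\
  (separated DeadlockFreedom StarvationFreedom /\
   separated StarvationFreedom PostDoorwayBoundedBypass /\
   separated StarvationFreedom IntermittentBoundedBypass /\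
   separated PostDoorwayBoundedBypass BoundedBypass /\
   separated IntermittentBoundedBypass BoundedBypass /\
   separated PostDoorwayBoundedBypass IntermittentBoundedBypass /\
   separated IntermittentBoundedBypass PostDoorwayBoundedBypass).
Proof.
have pd := separated_doorway_intermittent.
have ip := separated_intermittent_doorway.
split; last split.
- by do !split; apply: entails_obtained; do ?constructor.
- exact: separated_not_obtained.
- split; first exact: separated_deadlock_starvation.
  split; first exact: separated_mono intermittent_starvation (@entails_refl _) ip.
  split; first exact: separated_mono post_doorway_starvation (@entails_refl _) pd.
  split; first exact: separated_mono (@entails_refl _) bounded_intermittent pd.
  by split; first exact: separated_mono (@entails_refl _) bounded_post_doorway ip.
Qed.
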